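(* Let $(M,g,J,\Omega)$ be an almost Kähler manifold of real dimension 4 which is anti-self-dual and whose Ricci tensor is $J$-invariant. Then $(M,g,J,\Omega)$ is Kähler (hence scalar-flat, i.e. the scalar curvature of $g$ vanishes identically).
   Context: An almost Kähler structure on $M$ is a triple $(g,J,\Omega)$ of a Riemannian metric $g$, a $g$-orthogonal almost complex structure $J$, and a symplectic form $\Omega$ with $\Omega(X,Y)=g(JX,Y)$; it is Kähler if $J$ is integrable. $M$ is oriented by $J$ and is not assumed compact. Anti-self-dual means that the self-dual part $W^+$ of the Weyl tensor of $g$ vanishes. The Ricci tensor is $J$-invariant if $\mathrm{Ric}(JX,JY)=\mathrm{Ric}(X,Y)$ for all $X,Y$. *)

(* Defs.v *)
(* Vectors are row vectors and a tangent vector with components v in a chart is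
   sum_a v_a d/dx^a.  Matrices of bilinear forms and endomorphisms follow suit:
   B(v, w) = v *m B *m w^T, and an endomorphism J sends v to v *m J. *)
From HB Require Import structures.
From mathcomp Require Import all_boot all_order all_algebra.
From mathcomp Require Import all_classical all_reals all_analysis.

Set Implicit Arguments.
Unset Strict Implicit.
Unset Printing Implicit Defensive.

Import Order.TTheory GRing.Theory Num.Theory numFieldNormedType.Exports.

Local Open Scope classical_set_scope.
Local Open Scope ring_scope.

Section Calculus.
Variables (R : realType) (n : nat).

Definition pder (V : normedModType R) (k : 'I_n) (f : 'rV[R]_n -> V) :
    'rV[R]_n -> V :=
  fun x => 'D_(delta_mx 0 k) f x.

(* C^oo on an open set U: every iterated partial derivative is differentiable
   (hence exists and is continuous) at every point of U. *)
Definition smooth_on (V : normedModType R) (U : set 'rV[R]_n)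
    (f : 'rV[R]_n -> V) : Prop :=
  forall (s : seq 'I_n) (x : 'rV[R]_n), U x ->
    differentiable (foldr (@pder V) f s) x.

Definition lie_bracket (X Y : 'rV[R]_n -> 'rV[R]_n) (x : 'rV[R]_n) : 'rV[R]_n :=
  'D_(X x) Y x - 'D_(Y x) X x.

Definition endo_app (J : 'rV[R]_n -> 'M[R]_n) (X : 'rV[R]_n -> 'rV[R]_n)
    (x : 'rV[R]_n) : 'rV[R]_n :=
  X x *m J x.

(* N(X,Y) = [JX,JY] - J[JX,Y] - J[X,JY] - [X,Y] *)
Definition nijenhuis (J : 'rV[R]_n -> 'M[R]_n) (X Y : 'rV[R]_n -> 'rV[R]_n)
    (x : 'rV[R]_n) : 'rV[R]_n :=
  lie_bracket (endo_app J X) (endo_app J Y) x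
  - endo_app J (lie_bracket (endo_app J X) Y) x
  - endo_app J (lie_bracket X (endo_app J Y)) x
  - lie_bracket X Y x.

Definition ext_deriv2 (w : 'rV[R]_n -> 'M[R]_n) (a b c : 'I_n)
    (x : 'rV[R]_n) : R :=
  pder a (fun y => w y b c) x + pder b (fun y => w y c a) x
  + pder c (fun y => w y a b) x.

End Calculus.

Section Curvature.
Variables (R : realType) (n : nat) (G : 'rV[R]_n -> 'M[R]_n).
Implicit Types x : 'rV[R]_n.

(* Gamma^k_{ij} *)
Definition christoffel (k i j : 'I_n) x : R :=
  2^-1 * \sum_(l < n) invmx (G x) k l *
    (pder i (fun y => G y j l) x + pder j (fun y => G y i l) x
     - pder l (fun y => G y i j) x).

(* R(d_i, d_j) d_k = sum_l (riemann_up l i j k) d_l,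
   where R(X,Y) = [nabla_X, nabla_Y] - nabla_[X,Y] *)
Definition riemann_up (l i j k : 'I_n) x : R :=
  pder i (christoffel l j k) x - pder j (christoffel l i k) x
  + \sum_(m < n) (christoffel l i m x * christoffel m j k x
                  - christoffel l j m x * christoffel m i k x).

(* g(R(d_i, d_j) d_k, d_l) *)
Definition riemann (i j k l : 'I_n) x : R :=
  \sum_(m < n) riemann_up m i j k x * G x m l.

(* Ric(Y,Z) = tr (X |-> R(X,Y)Z), positive on round spheres *)
Definition ricci x : 'M[R]_n :=
  \matrix_(j, k) \sum_(i < n) riemann_up i i j k x.

Definition scalar_curvature x : R :=
  \sum_(j < n) \sum_(k < n) invmx (G x) j k * ricci x j k.

(* Totally trace-free part of riemann; meaningful for n >= 3. *)
Definition weyl (i j k l : 'I_n) x : R :=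
  riemann i j k l x
  - (n%:R - 2)^-1 *
      (ricci x j k * G x i l - ricci x i k * G x j l
       + G x j k * ricci x i l - G x i k * ricci x j l)
  + scalar_curvature x / ((n%:R - 1) * (n%:R - 2)) *
      (G x j k * G x i l - G x i k * G x j l).

End Curvature.

Section FourDim.
Variable R : realType.

Definition frame4 (u0 u1 u2 u3 : 'rV[R]_4) : 'M[R]_4 :=
  \matrix_(i < 4) nth 0 [:: u0; u1; u2; u3] i.

(* Sign of the standard basis for the orientation in which the bases
   (v, Jv, w, Jw) are positive; it does not depend on the choice of v, w. *)
Definition orientation (J : 'M[R]_4) : R :=
  xget 0 [set o | exists v w : 'rV[R]_4,
    let d := \det (frame4 v (v *m J) w (w *m J)) in
    d != 0 /\ o = Num.sg d].

Definition volume_form (G J : 'M[R]_4) (u0 u1 u2 u3 : 'rV[R]_4) : R :=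
  orientation J * Num.sqrt (\det G) * \det (frame4 u0 u1 u2 u3).

(* ( *alpha)_{ab} = 1/2 alpha^{pq} vol_{pqab} *)
Definition hodge_star (G J alpha : 'M[R]_4) : 'M[R]_4 :=
  \matrix_(a, b) (2^-1 * \sum_(p < 4) \sum_(q < 4)
    (invmx G *m alpha *m invmx G) p q *
    volume_form G J (delta_mx 0 p) (delta_mx 0 q)
                    (delta_mx 0 a) (delta_mx 0 b)).

Definition self_dual_part (G J alpha : 'M[R]_4) : 'M[R]_4 :=
  2^-1 *: (alpha + hodge_star G J alpha).

(* W^+; projecting the first pair of indices is enough since the Weyl tensor,
   viewed as an endomorphism of 2-forms, commutes with the Hodge star. *)
Definition weyl_plus (G J : 'rV[R]_4 -> 'M[R]_4) (i j k l : 'I_4)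
    (x : 'rV[R]_4) : R :=
  self_dual_part (G x) (J x) (\matrix_(a, b) weyl G a b k l x) i j.

End FourDim.

(* crd i is a homeomorphism from the open set dom i onto an open subset of R^n,
   with inverse par i; values outside these sets are irrelevant. *)
Record manifold (R : realType) (n : nat) := Manifold {
  carrier :> topologicalType;
  carrier_hausdorff : hausdorff_space carrier;
  carrier_second_countable : @second_countable carrier;
  chart : Type;
  dom : chart -> set carrier;
  crd : chart -> carrier -> 'rV[R]_n;
  par : chart -> 'rV[R]_n -> carrier;
  dom_cover : forall p, exists i, dom i p;
  dom_open : forall i, open (dom i);
  crd_open : forall i, open (crd i @` dom i);
  crdK : forall i p, dom i p -> par i (crd i p) = p;
  crd_continuous : forall i, {within dom i, continuous (crd i)};
  par_continuous : forall i, {within crd i @` dom i, continuous (par i)};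
  transition_smooth : forall i j,
    smooth_on (crd i @` (dom i `&` dom j)) (crd j \o par i)
}.

Section Tensors.
Variables (R : realType) (n : nat) (M : manifold R n).

Definition chart_image (i : chart M) : set 'rV[R]_n := crd i @` dom i.

(* Components of a field of bilinear forms or endomorphisms in every chart,
   as functions of the coordinates. *)
Local Notation components := (chart M -> 'rV[R]_n -> 'M[R]_n).

Definition transition_jacobian (i j : chart M) (p : M) : 'M[R]_n :=
  'J (crd j \o par i) (crd i p).

Definition bilinear_tensor (T : components) : Prop :=
  (forall i, smooth_on (chart_image i) (T i)) /\
  forall i j p, dom i p -> dom j p ->
    let D := transition_jacobian i j p in
    T i (crd i p) = D *m T j (crd j p) *m D^T.

Definition endomorphism_tensor (T : components) : Prop :=
  (forall i, smooth_on (chart_image i) (T i)) /\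
  forall i j p, dom i p -> dom j p ->
    let D := transition_jacobian i j p in
    T i (crd i p) *m D = D *m T j (crd j p).

Record riemannian_metric := RiemannianMetric {
  metric :> components;
  metric_tensor : bilinear_tensor metric;
  metric_sym : forall i x, chart_image i x -> (metric i x)^T = metric i x;
  metric_pos : forall i x, chart_image i x ->
    forall v : 'rV[R]_n, v != 0 -> 0 < (v *m metric i x *m v^T) 0 0
}.

Record almost_complex := AlmostComplex {
  acs :> components;
  acs_tensor : endomorphism_tensor acs;
  acs_sqr : forall i x, chart_image i x -> acs i x *m acs i x = - 1%:M
}.

Record symplectic_form := SymplecticForm {
  sform :> components;
  sform_tensor : bilinear_tensor sform;
  sform_alt : forall i x, chart_image i x -> (sform i x)^T = - sform i x;
  sform_nondegenerate : forall i x, chart_image i x -> sform i x \in unitmx;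
  sform_closed : forall i x, chart_image i x ->
    forall a b c, ext_deriv2 (sform i) a b c x = 0
}.

(* Omega(X,Y) = g(JX,Y) *)
Record almost_kahler := AlmostKahler {
  ak_metric : riemannian_metric;
  ak_acs : almost_complex;
  ak_form : symplectic_form;
  ak_orthogonal : forall i x, chart_image i x ->
    ak_acs i x *m ak_metric i x *m (ak_acs i x)^T = ak_metric i x;
  ak_compatible : forall i x, chart_image i x ->
    ak_form i x = ak_acs i x *m ak_metric i x
}.

Definition integrable (J : almost_complex) : Prop :=
  forall (i : chart M) (X Y : 'rV[R]_n -> 'rV[R]_n),
    smooth_on (chart_image i) X -> smooth_on (chart_image i) Y ->
    forall x, chart_image i x -> nijenhuis (J i) X Y x = 0.

Definition kahler (S : almost_kahler) : Prop := integrable (ak_acs S).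

(* Ric(JX,JY) = Ric(X,Y) *)
Definition ricci_J_invariant (S : almost_kahler) : Prop :=
  forall (i : chart M) x, chart_image i x ->
    ak_acs S i x *m ricci (ak_metric S i) x *m (ak_acs S i x)^T
    = ricci (ak_metric S i) x.

Definition scalar_flat (g : riemannian_metric) : Prop :=
  forall (i : chart M) x, chart_image i x -> scalar_curvature (g i) x = 0.

End Tensors.

Definition anti_self_dual (R : realType) (M : manifold R 4)
    (S : almost_kahler M) : Prop :=
  forall (i : chart M) x, chart_image i x ->
    forall a b c d, weyl_plus (ak_metric S i) (ak_acs S i) a b c d x = 0.

(* Main.v *)
Require Import Defs.
From HB Require Import structures.
From mathcomp Require Import all_boot all_order all_algebra.
From mathcomp Require Import all_classical all_reals all_analysis.
From mathcomp Require Import ring lra.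

(** The four-dimensional theory is local, so let E = (e0, e1 = J e0, e2, e3 = J e2)
    be an orthonormal frame on an open subset of a chart.  The self-dual 2-forms
    are spanned by w1 = Omega and by two forms w2, w3, represented by the matrices
    [J1], [J2], [J3], and the Levi-Civita connection induces on them three
    connection 1-forms S1, S2, S3, of which S2 and S3 are the components of the
    covariant derivative of J ([frameJ_sd]).

    When W^+ = 0 and Ric is J-invariant, the curvature of the self-dual bundle is
    almost determined: with k = - s / 12, its components along w2 and w3 are k w2
    and k w3 ([asd_curvature23]), and its component along w1 is k w1 plus an
    anti-self-dual form ([asd_curvature1]).  If J is parallel, the curvature
    commutes with J, so that the w2 component vanishes and s = 0
    ([parallel_scalar_flat]); moreover J is integrable, because the connection is
    torsion-free ([parallel_integrable]).

    It remains to see that J is parallel ([acs_parallel]).  Otherwise some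
    component of its covariant derivative vanishes nowhere on a smaller open set.
    There the closedness of Omega lets one choose the frame so that S3 = r e^0 and
    S2 = r e^1 with r nowhere zero ([nablaJ_nowhere_absurd],
    [gauged_frame_absurd]).  The rest is a computation in this frame, which ends
    in [adapted_frame_absurd].  The structure equations for S2 and S3 give
    2 k = r^2.  The second Bianchi identity gives dk = 0 and kills the
    anti-self-dual form above, so r is constant too.  All connection coefficients
    are then expressed by S1, by the constant h = r / 2 and by two functions p and
    q ([normal_form]).  The first Bianchi identity shows that p^2 + q^2 = 6 h^2,
    and that p and q are rotated into each other: along e2 and e3 one has
    dp = 5 S1 q and dq = - 5 S1 p.  The integrability condition of this system in
    the plane of e2 and e3 is 5 dS1(e2, e3) p = 5 dS1(e2, e3) q = 0, whereas
    dS1(e2, e3) = k = 2 h^2.  Hence p = q = 0, and h = 0, a contradiction.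

    The identities are proved in a commutative ring with commuting derivations,
    where they are polynomial; the smooth functions on an open set V form such a
    ring.  Evaluation at points serves for the algebra of curvature tensors, for
    divisions by nonvanishing functions, and for positivity. *)

Set Implicit Arguments.
Unset Strict Implicit.
Unset Printing Implicit Defensive.

Import Order.TTheory GRing.Theory Num.Theory numFieldNormedType.Exports.

Local Open Scope classical_set_scope.
Local Open Scope ring_scope.

(** * Symmetry of mixed partial derivatives *)

Section SecondDifference.
Variables (R : realType) (n : nat).
Implicit Types (f : 'rV[R]_n -> R) (V : set 'rV[R]_n) (u v x : 'rV[R]_n).

Lemma is_derive_line f u x (t : R) : differentiable f (x + t *: u) ->
  is_derive t 1 (fun s : R => f (x + s *: u)) ('D_u f (x + t *: u)).
Proof.
move=> df.
pose l := fun s : R => x + s *: u.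
have dl : is_diff t l (fun s => s *: u).
  rewrite /l.
  apply: is_diff_eq.
  by rewrite funeqE => s /=; rewrite add0r.
have dfl : differentiable f (l t) by [].
have dfl' : is_diff t (f \o l) ('d f (l t) \o (fun s => s *: u)).
  have := differentiableP dfl => ?; exact: is_diff_comp.
have dd : differentiable (f \o l) t by [].
split; first exact: diff_derivable.
rewrite [LHS](deriveE _ (dd)) diff_val /= scale1r.
by rewrite deriveE.
Qed.

Definition second_diff f u v x (h : R) : R :=
  f (x + h *: v + h *: u) - f (x + h *: u) - f (x + h *: v) + f x.

Lemma second_diffC f u v x h : second_diff f u v x h = second_diff f v u x h.
Proof. by rewrite /second_diff (addrAC x); ring. Qed.

Lemma diff_littleo f x (e : R) : differentiable f x -> 0 < e ->
  exists2 d : R, 0 < d & forall w, `|w| < d ->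
    `|f (x + w) - f x - 'd f x w| <= e * `|w|.
Proof.
move=> /diff_locally df e0.
have /eqaddoP/(_ _ e0)/nbhs_ballP[d /= d0 H] := df.
exists d => // w wd; have := H w; rewrite -ball_normE /= sub0r normrN => /(_ wd).
by rewrite opprD addrA [x + w]addrC.
Qed.

(** The mean value theorem along u turns the second difference into h times the
    increment over h v of the derivative along u; the linear part of this
    increment is h times the mixed derivative. *)
Lemma second_diff_estimate f V u v x (e : R) : open V -> V x ->
  (forall y, V y -> differentiable f y) ->
  differentiable (fun y => 'D_u f y) x -> 0 < e ->
  \forall h \near (0:R)^'+,
    `|second_diff f u v x h - h ^+ 2 * 'D_v (fun y => 'D_u f y) x| <= e * h ^+ 2.
Proof.
move=> oV Vx df dg e0.
pose m := 2 * `|u| + `|v| + 1.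
have m0 : 0 < m by rewrite /m; have := normr_ge0 u; have := normr_ge0 v; lra.
have [d d0 Hd] := diff_littleo dg (divr_gt0 e0 m0).
have /nbhs_ballP[d' /= d'0 HV] : nbhs x V by apply: open_nbhs_nbhs.
near=> h.
have h0 : 0 < h by near: h; exact: nbhs_right_gt.
have hd : h * m < d.
  by rewrite -ltr_pdivlMr//; near: h; apply: nbhs_right_lt; rewrite divr_gt0.
have hd' : h * m < d'.
  by rewrite -ltr_pdivlMr//; near: h; apply: nbhs_right_lt; rewrite divr_gt0.
have bnd (s t : R) : 0 <= s <= h -> 0 <= t <= h ->
    `|s *: v + t *: u| <= h * (`|u| + `|v|).
  move=> /andP[s0 sh] /andP[t0 th].
  rewrite (le_trans (ler_normD _ _))// !normrZ (ger0_norm s0) (ger0_norm t0).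
  by have := normr_ge0 u; have := normr_ge0 v; nra.
have small (s t : R) : 0 <= s <= h -> 0 <= t <= h ->
    `|s *: v + t *: u| < d /\ V (x + (s *: v + t *: u)).
  move=> hs ht; have B := bnd _ _ hs ht.
  have B2 : h * (`|u| + `|v|) < h * m.
    by rewrite ltr_pM2l// /m; have := normr_ge0 u; lra.
  split; first by lra.
  by apply: HV; rewrite -ball_normE /= opprD addNKr normrN; lra.
pose phi := fun s : R => f (x + h *: v + s *: u) - f (x + s *: u).
pose dphi := fun s : R => 'D_u f (x + h *: v + s *: u) - 'D_u f (x + s *: u).
have hh : 0 <= h <= h by rewrite lexx ltW.
have h00 : 0 <= (0:R) <= h by rewrite lexx ltW.
have dphiP s : 0 <= s <= h -> is_derive s 1 phi (dphi s).
  move=> hs; apply: is_deriveB; apply: is_derive_line; apply: df.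
    by rewrite -addrA; apply: (small _ _ hh hs).2.
  by have := (small _ _ h00 hs).2; rewrite scale0r add0r.
have [s sI] : exists2 s, s \in `]0, h[%R & phi h - phi 0 = dphi s * (h - 0).
  apply: MVT => //.
    by move=> s; rewrite in_itv/= => /andP[/ltW s0 /ltW sh]; apply: dphiP; rewrite s0.
  apply: derivable_within_continuous => s; rewrite in_itv/= => sh.
  by have [] := dphiP s sh.
have {sI} hs : 0 <= s <= h by move: sI; rewrite in_itv/= => /andP[/ltW -> /ltW ->].
have -> : phi h - phi 0 = second_diff f u v x h.
  by rewrite /phi /second_diff scale0r !addr0; ring.
rewrite subr0 => ->.
set g := fun y => 'D_u f y in dg Hd *.
have E1 := Hd _ (small _ _ hh hs).1.
have E2 := Hd _ (small _ _ h00 hs).1.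
have N1 := bnd _ _ hh hs.
have N2 := bnd _ _ h00 hs.
have -> : 'D_v g x = 'd g x v by rewrite deriveE.
move: E1 E2 N2; rewrite linearD linearZ /= [0%R *: v]scale0r add0r linearZ /= !addrA => E1 E2 N2.
have Edphi : dphi s = g (x + h *: v + s *: u) - g (x + s *: u) by [].
have N2' : `|s *: u| <= h * `|u|.
  move: hs => /andP[s0 sh]; rewrite normrZ (ger0_norm s0).
  by have := normr_ge0 u; nra.
move: E1 E2; rewrite Edphi -!/(GRing.scale _ _) /GRing.scale /=.
set a := g _; set b := g (x + s *: u); set c := g x; set D := 'd g x v.
set D' := 'd g x u => E1 E2.
have -> : (a - b) * h - h ^+ 2 * D = h * ((a - c - (h * D + s * D')) - (b - c - s * D')).
  by ring.
rewrite normrM (ger0_norm (ltW h0)) expr2 mulrCA ler_pM2l//.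
rewrite (le_trans (ler_normB _ _))// (le_trans (lerD E1 E2))//.
rewrite -mulrDr mulrAC ler_pdivrMr// -mulrA ler_pM2l//.
rewrite (le_trans (lerD N1 N2'))// -mulrDr ler_pM2l// /m; lra.
Unshelve. all: by end_near. Qed.

(** Both iterated derivatives are limits of the same symmetric second
    difference quotient. *)
Lemma derive_comm f V u v x : open V -> V x ->
  (forall y, V y -> differentiable f y) ->
  differentiable (fun y => 'D_u f y) x ->
  differentiable (fun y => 'D_v f y) x ->
  'D_v (fun y => 'D_u f y) x = 'D_u (fun y => 'D_v f y) x.
Proof.
move=> oV Vx df du dv.
have H1 e := @second_diff_estimate f V u v x e oV Vx df du.
have H2 e := @second_diff_estimate f V v u x e oV Vx df dv.
move: ('D_v _ x) ('D_u _ x) H1 H2 => a b H1 H2.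
apply/eqP/negPn/negP => neq.
have ab0 : 0 < `|a - b| by rewrite normr_gt0 subr_eq0.
have e0 : 0 < `|a - b| / 4 by lra.
have /filter_ex[h [[h0 L1] L2]] : \forall h \near (0:R)^'+,
    (0 < h /\ `|second_diff f u v x h - h ^+ 2 * a| <= `|a - b| / 4 * h ^+ 2)
    /\ `|second_diff f v u x h - h ^+ 2 * b| <= `|a - b| / 4 * h ^+ 2.
  by apply: filterI (H2 _ e0); apply: filterI (H1 _ e0); exact: nbhs_right_gt.
have h2 : 0 < h ^+ 2 by rewrite exprn_gt0.
move: L1 L2; rewrite (second_diffC f v u).
move: (second_diff _ _ _ _ _) => s L1 L2.
have := ler_normB (s - h ^+ 2 * b) (s - h ^+ 2 * a).
have -> : s - h ^+ 2 * b - (s - h ^+ 2 * a) = h ^+ 2 * (a - b) by ring.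
rewrite normrM (gtr0_norm h2) => L3.
suff : h ^+ 2 * `|a - b| <= h ^+ 2 * (`|a - b| / 2) by rewrite ler_pM2l//; lra.
by apply: le_trans L3 (le_trans (lerD L2 L1) _); lra.
Qed.

End SecondDifference.

(** * The ring of smooth functions on an open set *)

Lemma near_eq_differentiable (R : numFieldType) (V W : normedModType R)
    (f g : V -> W) (x : V) :
  {near x, f =1 g} -> differentiable f x -> differentiable g x.
Proof.
move=> fg /diff_locallyP[dc df].
have gE : g \o shift x = cst (g x) + 'd f x +o_ 0 id.
  apply/eqaddoP => e e0; have /eqaddoP/(_ e e0) := df => H.
  have fg0 : \forall w \near (0:V), f (w + x) = g (w + x).
    move: fg => /nbhs_ballP[d d0 H']; apply/nbhs_ballP; exists d => // w.
    rewrite -!ball_normE /= sub0r normrN => wd; apply: H'.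
    by rewrite -ball_normE /= opprD addrCA subrr addr0 normrN.
  apply: filterS2 fg0 H => w /= fgw.
  rewrite !fctE /= /shift /= in fgw *.
  by rewrite fgw (nbhs_singleton fg).
by apply/diff_locallyP; rewrite (diff_unique dc gE).
Qed.

Section SmoothCalculus.
Variables (R : realType) (n : nat) (V : set 'rV[R]_n).
Hypothesis oV : open V.

Section AnyTarget.
Variable W : normedModType R.
Implicit Types f g : 'rV[R]_n -> W.

Lemma near_eq_on f g x : (forall y, V y -> f y = g y) -> V x ->
  {near x, f =1 g}.
Proof.
by move=> fg Vx; apply: filterS (open_nbhs_nbhs (conj oV Vx)) => y /fg.
Qed.

Lemma pder_eq_on f g k x : (forall y, V y -> f y = g y) -> V x ->
  pder k f x = pder k g x.
Proof. by move=> fg Vx; apply: near_eq_derive; apply: near_eq_on fg Vx. Qed.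

(** The recursive form of [smooth_on], along which the closure properties are
    proved by induction. *)
Fixpoint times_diff m f : Prop :=
  if m is m'.+1 then
    (forall x, V x -> differentiable f x) /\ forall k, times_diff m' (pder k f)
  else True.

Lemma smooth_onP f : smooth_on V f <-> forall m, times_diff m f.
Proof.
split=> [sf m|df s x Vx].
  elim: m f sf => //= m IH f sf; split; first exact: (sf [::]).
  move=> k; apply: IH => s x Vx; have := sf (rcons s k) x Vx.
  by rewrite foldr_rcons.
elim/last_ind: s f df => [|s k IH] f df; first exact: (df 1%N).1.
by rewrite foldr_rcons; apply: IH => m; exact: (df m.+1).2.
Qed.

Lemma times_diff_eq_on f g m : (forall y, V y -> f y = g y) ->
  times_diff m f -> times_diff m g.
Proof.
elim: m f g => //= m IH f g fg [df ddf]; split=> [x Vx|k].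
  exact: near_eq_differentiable (near_eq_on fg Vx) (df x Vx).
by apply: IH (ddf k) => x Vx; exact: pder_eq_on.
Qed.

Lemma smooth_eq_on f g : (forall y, V y -> f y = g y) ->
  smooth_on V f -> smooth_on V g.
Proof.
move=> fg /smooth_onP sf; apply/smooth_onP => m.
exact: times_diff_eq_on fg (sf m).
Qed.

Lemma smooth_diff f x : smooth_on V f -> V x -> differentiable f x.
Proof. by move=> sf; exact: (sf [::]). Qed.

Lemma smooth_pder f k : smooth_on V f -> smooth_on V (pder k f).
Proof. by move=> /smooth_onP sf; apply/smooth_onP => m; exact: (sf m.+1).2. Qed.

End AnyTarget.

Lemma smooth_entry p q (f : 'rV[R]_n -> 'M[R]_(p, q)) i j :
  smooth_on V f -> smooth_on V (fun x => f x i j).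
Proof.
move=> /smooth_onP sf; apply/smooth_onP => m.
elim: m f {sf}(sf m) => //= m IH f [df ddf]; split=> [x Vx|k].
  apply: (@differentiable_comp _ _ _ _ f (fun N : 'M[R]_(p, q) => N i j : R) x) => //.
    exact: df.
  exact: differentiable_coord.
apply: times_diff_eq_on (IH _ (ddf k)) => x Vx.
by rewrite /pder derive_mx ?mxE//; apply: diff_derivable; exact: df.
Qed.

Implicit Types f g : 'rV[R]_n -> R.

Lemma pderD f g k x : differentiable f x -> differentiable g x ->
  pder k (fun y => f y + g y) x = pder k f x + pder k g x.
Proof. by move=> df dg; apply: deriveD; exact: diff_derivable. Qed.

Lemma pderN f k x : differentiable f x ->
  pder k (fun y => - f y) x = - pder k f x.
Proof. by move=> df; apply: deriveN; exact: diff_derivable. Qed.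

Lemma pderM f g k x : differentiable f x -> differentiable g x ->
  pder k (fun y => f y * g y) x = pder k f x * g x + f x * pder k g x.
Proof.
move=> df dg; rewrite /pder [LHS]deriveM; [|exact: diff_derivable..].
by rewrite addrC /GRing.scale /= [g x * _]mulrC.
Qed.

Lemma pder_cst (a : R) k x : pder k (fun _ : 'rV[R]_n => a) x = 0.
Proof. exact: derive_cst. Qed.

Lemma times_diff_cst a m : times_diff m (fun _ : 'rV[R]_n => a : R).
Proof.
elim: m a => //= m IH a; split=> [x _|k]; first exact: differentiable_cst.
by apply: times_diff_eq_on (IH 0) => x _; rewrite pder_cst.
Qed.

Lemma times_diffW m f : times_diff m.+1 f -> times_diff m f.
Proof.
elim: m f => //= m IH f [df ddf]; split => // k; exact: IH (ddf k).
Qed.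

Lemma times_diffD m f g : times_diff m f -> times_diff m g ->
  times_diff m (fun y => f y + g y).
Proof.
elim: m f g => //= m IH f g [df ddf] [dg ddg]; split=> [x Vx|k].
  exact: differentiableD (df x Vx) (dg x Vx).
apply: times_diff_eq_on (IH _ _ (ddf k) (ddg k)) => x Vx.
by rewrite pderD; [|exact: df|exact: dg].
Qed.

Lemma times_diffM m f g : times_diff m f -> times_diff m g ->
  times_diff m (fun y => f y * g y).
Proof.
elim: m f g => //= m IH f g [df ddf] [dg ddg]; split=> [x Vx|k].
  exact: differentiableM (df x Vx) (dg x Vx).
have fm : times_diff m f by apply: times_diffW.
have gm : times_diff m g by apply: times_diffW.
apply: times_diff_eq_on (times_diffD (IH _ _ (ddf k) gm) (IH _ _ fm (ddg k))).
by move=> x Vx; rewrite pderM; [|exact: df|exact: dg].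
Qed.

Lemma smooth_cst (a : R) : smooth_on V (fun _ => a).
Proof. by apply/smooth_onP => m; exact: times_diff_cst. Qed.

Lemma smoothD f g : smooth_on V f -> smooth_on V g ->
  smooth_on V (fun y => f y + g y).
Proof.
by move=> /smooth_onP sf /smooth_onP sg; apply/smooth_onP => m; exact: times_diffD.
Qed.

Lemma smoothM f g : smooth_on V f -> smooth_on V g ->
  smooth_on V (fun y => f y * g y).
Proof.
by move=> /smooth_onP sf /smooth_onP sg; apply/smooth_onP => m; exact: times_diffM.
Qed.

Lemma smoothN f : smooth_on V f -> smooth_on V (fun y => - f y).
Proof.
move=> sf; apply: smooth_eq_on (smoothM (smooth_cst (-1)) sf) => y _.
by rewrite mulN1r.
Qed.

Lemma pder_comm f i j x : smooth_on V f -> V x ->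
  pder i (pder j f) x = pder j (pder i f) x.
Proof.
move=> sf Vx; apply: (@derive_comm _ _ f V) => //.
- by move=> y; exact: smooth_diff.
- by apply: (smooth_diff (smooth_pder j sf)).
- by apply: (smooth_diff (smooth_pder i sf)).
Qed.

Definition rsqrt f x : R := (Num.sqrt (f x))^-1.

Lemma rsqrt_sqr f x : 0 < f x -> rsqrt f x * rsqrt f x * f x = 1.
Proof.
move=> fx; rewrite /rsqrt -invfM -expr2 sqr_sqrtr ?ltW//.
by rewrite mulVf// gt_eqF.
Qed.

(** Differentiating h^2 f = 1 shows that h = f^(-1/2) has derivatives
    - h^3 f' / 2, polynomial in h and in the derivatives of f. *)
Lemma smooth_rsqrt f : smooth_on V f -> (forall x, V x -> 0 < f x) ->
  smooth_on V (rsqrt f).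
Proof.
move=> sf f0.
have dh x : V x -> differentiable (rsqrt f) x.
  move=> Vx; apply: differentiableV; last by rewrite sqrtr_eq0 -ltNge f0.
  apply: differentiable_comp; first exact: smooth_diff.
  by apply/derivable1_diffP; have [] := is_derive1_sqrt (f0 x Vx).
have ph k x : V x ->
    - 2^-1 * (rsqrt f x * (rsqrt f x * rsqrt f x)) * pder k f x = pder k (rsqrt f) x.
  move=> Vx.
  have E : pder k (fun y => rsqrt f y * rsqrt f y * f y) x = 0.
    rewrite -[RHS](pder_cst 1 k x); apply: pder_eq_on Vx => y Vy.
    exact/rsqrt_sqr/f0.
  move: E; rewrite pderM; [|exact: differentiableM (dh x Vx) (dh x Vx)|exact: smooth_diff].
  rewrite pderM; [|exact: dh|exact: dh] => E.
  have E1 := rsqrt_sqr (f0 x Vx).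
  move: (pder k (rsqrt f) x) (rsqrt f x) (pder k f x) (f x) E E1 => a h d t E E1.
  have -> : - 2^-1 * (h * (h * h)) * d = a * (h * h * t)
     - 2^-1 * h * ((a * h + h * a) * t + h * h * d) by field.
  by rewrite E E1; ring.
apply/smooth_onP => m; elim: m => //= m IH; split=> // k.
have pf : times_diff m (pder k f) by move/smooth_onP: (smooth_pder k sf).
apply: times_diff_eq_on (times_diffM (times_diffM (times_diff_cst _ _)
  (times_diffM IH (times_diffM IH IH))) pf) => x.
exact: ph.
Qed.

End SmoothCalculus.

(** Functions that are smooth on V, normalized to vanish off V so that two of
    them are equal as soon as they agree on V. *)
Record smoothfun (R : realType) n (V : set 'rV[R]_n) (oV : open V) := SmoothFun {
  sfun :> 'rV[R]_n -> R;
  sfun_smooth : smooth_on V sfun;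
  sfun_out : forall x, ~ V x -> sfun x = 0
}.

Section SmoothRing.
Variables (R : realType) (n : nat) (V : set 'rV[R]_n) (oV : open V).
Local Notation A := (smoothfun oV).
Implicit Types (a b c : A) (f g : 'rV[R]_n -> R).

Lemma smoothfunP a b : (forall x, V x -> a x = b x) -> a = b.
Proof.
case: a b => [f sf of_] [g sg og] /= fg.
have E : f = g.
  apply/funext => x; case: (pselect (V x)) => Vx; first exact: fg.
  by rewrite of_ ?og.
by rewrite {}E in sf of_ fg *; congr SmoothFun; exact: Prop_irrelevance.
Qed.

Definition cut f x : R := if pselect (V x) then f x else 0.

Lemma cut_in f x : V x -> cut f x = f x.
Proof. by rewrite /cut; case: pselect. Qed.

Lemma cut_out f x : ~ V x -> cut f x = 0.
Proof. by rewrite /cut; case: pselect. Qed.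

Lemma cut_smooth f : smooth_on V f -> smooth_on V (cut f).
Proof. by apply: (smooth_eq_on oV) => x Vx; rewrite cut_in. Qed.

(** The operations below are specified by their values on V and are otherwise
    opaque: unfolding them would only expose proofs of smoothness. *)
Fact smooth_ext f (sf : smooth_on V f) : {a : A | forall x, V x -> a x = f x}.
Proof. by exists (SmoothFun oV (cut_smooth sf) (@cut_out f)); exact: cut_in. Qed.

Definition tosmooth f (sf : smooth_on V f) : A := sval (smooth_ext sf).

Lemma tosmoothE f (sf : smooth_on V f) x : V x -> tosmooth sf x = f x.
Proof. exact: svalP (smooth_ext sf) x. Qed.

HB.instance Definition _ := gen_eqMixin A.
HB.instance Definition _ := gen_choiceMixin A.

Definition sf_cst (r : R) : A := tosmooth (smooth_cst oV r).

Fact sf_add_sig a b : {c : A | forall x, V x -> c x = a x + b x}.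
Proof. exact: smooth_ext (smoothD oV (sfun_smooth a) (sfun_smooth b)). Qed.
Definition sf_add a b : A := sval (sf_add_sig a b).
Lemma sf_addE a b x : V x -> sf_add a b x = a x + b x.
Proof. exact: svalP (sf_add_sig a b) x. Qed.

Fact sf_opp_sig a : {c : A | forall x, V x -> c x = - a x}.
Proof. exact: smooth_ext (smoothN oV (sfun_smooth a)). Qed.
Definition sf_opp a : A := sval (sf_opp_sig a).
Lemma sf_oppE a x : V x -> sf_opp a x = - a x.
Proof. exact: svalP (sf_opp_sig a) x. Qed.

Fact sf_mul_sig a b : {c : A | forall x, V x -> c x = a x * b x}.
Proof. exact: smooth_ext (smoothM oV (sfun_smooth a) (sfun_smooth b)). Qed.
Definition sf_mul a b : A := sval (sf_mul_sig a b).
Lemma sf_mulE a b x : V x -> sf_mul a b x = a x * b x.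
Proof. exact: svalP (sf_mul_sig a b) x. Qed.

Local Ltac pointwise :=
  move=> *; apply: smoothfunP => x Vx;
  rewrite ?(sf_addE, sf_mulE, sf_oppE) // ?tosmoothE //; ring.

Fact sf_addA : associative sf_add. Proof. pointwise. Qed.
Fact sf_addC : commutative sf_add. Proof. pointwise. Qed.
Fact sf_add0 : left_id (sf_cst 0) sf_add. Proof. pointwise. Qed.
Fact sf_addN : left_inverse (sf_cst 0) sf_opp sf_add. Proof. pointwise. Qed.
Fact sf_mulA : associative sf_mul. Proof. pointwise. Qed.
Fact sf_mulC : commutative sf_mul. Proof. pointwise. Qed.
Fact sf_mul1 : left_id (sf_cst 1) sf_mul. Proof. pointwise. Qed.
Fact sf_mulDl : left_distributive sf_mul sf_add. Proof. pointwise. Qed.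

HB.instance Definition _ := GRing.isZmodule.Build A sf_addA sf_addC sf_add0 sf_addN.
HB.instance Definition _ :=
  GRing.Zmodule_isComPzRing.Build A sf_mulA sf_mulC sf_mul1 sf_mulDl.

Section Evaluation.
Variables (x : 'rV[R]_n) (Vx : V x).

Definition ev of V x := fun a : A => a x.
Arguments ev : simpl never.

Fact ev_is_additive : {morph ev Vx : a b / a - b}.
Proof. by move=> a b; rewrite /ev [LHS]sf_addE// sf_oppE. Qed.
Fact ev_is_multiplicative : {morph ev Vx : a b / a * b} * (ev Vx 1 = 1).
Proof.
by split=> [a b|]; rewrite /ev; [exact: sf_mulE|exact: tosmoothE].
Qed.

HB.instance Definition _ := GRing.isAdditive.Build A R (ev Vx) ev_is_additive.
HB.instance Definition _ :=
  GRing.isMultiplicative.Build A R (ev Vx) ev_is_multiplicative.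

End Evaluation.
Arguments ev {x} Vx a : simpl never.

Lemma evP a b : (forall x (Vx : V x), ev Vx a = ev Vx b) -> a = b.
Proof. by move=> ab; apply: smoothfunP => x Vx; exact: ab. Qed.

Fact sderiv_sig k a : {c : A | forall x, V x -> c x = pder k a x}.
Proof. exact: smooth_ext (smooth_pder k (sfun_smooth a)). Qed.
Definition sderiv k a : A := sval (sderiv_sig k a).

Lemma sderivE k a x : V x -> sderiv k a x = pder k a x.
Proof. exact: svalP (sderiv_sig k a) x. Qed.

Lemma ev_sderiv k a x (Vx : V x) : ev Vx (sderiv k a) = pder k a x.
Proof. exact: sderivE. Qed.

Let da a x : V x -> differentiable a x.
Proof. exact/smooth_diff/sfun_smooth. Qed.

Fact sderiv_is_additive k : {morph sderiv k : a b / a - b}.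
Proof.
move=> a b; apply: evP => x Vx; rewrite (rmorphB (ev Vx)) /= !ev_sderiv.
have /= -> := pder_eq_on (g := fun y => a y + (- b y)) oV k _ Vx.
  by rewrite pderD ?pderN//; try exact: da; apply: differentiableN; exact: da.
by move=> y Vy; have := rmorphB (ev Vy) a b.
Qed.
HB.instance Definition _ k := GRing.isAdditive.Build A A (sderiv k) (sderiv_is_additive k).

Lemma sderivM k a b : sderiv k (a * b) = sderiv k a * b + a * sderiv k b.
Proof.
apply: evP => x Vx; rewrite (rmorphD (ev Vx)) !(rmorphM (ev Vx)) /= !ev_sderiv.
rewrite -pderM; [|exact: da..].
by apply: (pder_eq_on oV) Vx => y Vy; exact: (rmorphM (ev Vy) a b).
Qed.

Lemma sderiv_comm i j a : sderiv i (sderiv j a) = sderiv j (sderiv i a).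
Proof.
have E l m x (Vx : V x) : ev Vx (sderiv l (sderiv m a)) = pder l (pder m a) x.
  by rewrite ev_sderiv; apply: (pder_eq_on oV) Vx => y Vy; rewrite sderivE.
apply: evP => x Vx.
exact: etrans (E i j x Vx) (etrans (pder_comm oV i j (sfun_smooth a) Vx) (esym (E j i x Vx))).
Qed.

(** This normalizes vector fields.  Applied to the square of a nowhere vanishing
    function f, it also yields the inverse h^2 f of f. *)
Lemma exists_rsqrt a : (forall x (Vx : V x), 0 < ev Vx a) ->
  exists2 h : A, h * h * a = 1 & forall x (Vx : V x), 0 < ev Vx h.
Proof.
move=> a0.
have sh : smooth_on V (rsqrt a).
  by apply: smooth_rsqrt a0 => //; exact: sfun_smooth.
have [h hE] : exists h : A, forall x (Vx : V x), ev Vx h = rsqrt a x.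
  by exists (tosmooth sh) => x Vx; exact: tosmoothE.
exists h.
  apply: evP => x Vx; rewrite !(rmorphM (ev Vx)) (rmorph1 (ev Vx)) /= hE.
  exact/rsqrt_sqr/(a0 x Vx).
by move=> x Vx; rewrite hE invr_gt0 sqrtr_gt0; exact: (a0 x Vx).
Qed.

End SmoothRing.

(** * Connections and moving frames over a differential ring *)

Lemma exchange_big3 n (A : nmodType) (f : 'I_n -> 'I_n -> 'I_n -> A) :
  \sum_i \sum_j \sum_k f i j k = \sum_k \sum_i \sum_j f i j k.
Proof.
rewrite [RHS]exchange_big; apply: eq_bigr => i _; exact: exchange_big.
Qed.

Section DifferentialRing.
Variables (n : nat) (A : comPzRingType) (D : 'I_n -> {additive A -> A}).
Hypothesis DM : forall i a b, D i (a * b) = D i a * b + a * D i b.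
Hypothesis D_comm : forall i j a, D i (D j a) = D j (D i a).
Implicit Types (i j k : 'I_n).

Local Notation "''D[' i ] M" := (map_mx (D i) M) (at level 9, i at level 50, M at level 9).

Lemma mxDE p q (M N : 'M[A]_(p, q)) s t : (M + N) s t = M s t + N s t.
Proof. by rewrite mxE. Qed.
Lemma mxNE p q (M : 'M[A]_(p, q)) s t : (- M) s t = - M s t.
Proof. by rewrite mxE. Qed.
Lemma mx_trD p q (M N : 'M[A]_(p, q)) : (M + N)^T = M^T + N^T.
Proof. by apply/matrixP => s t; rewrite !mxE. Qed.
Lemma mx_trN p q (M : 'M[A]_(p, q)) : (- M)^T = - M^T.
Proof. by apply/matrixP => s t; rewrite !mxE. Qed.

Ltac mxzmod := apply/matrixP => ? ?; rewrite !(mxDE, mxNE); ring.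

Lemma D_mulmx i p q r (M : 'M[A]_(p, q)) (N : 'M[A]_(q, r)) :
  'D[i](M *m N) = 'D[i] M *m N + M *m 'D[i] N.
Proof.
apply/matrixP => s t; rewrite !mxE raddf_sum -big_split /=.
by apply: eq_bigr => u _; rewrite DM !mxE.
Qed.

Lemma D_commx i j p q (M : 'M[A]_(p, q)) : 'D[i]('D[j] M) = 'D[j]('D[i] M).
Proof. by apply/matrixP => s t; rewrite !mxE. Qed.

Lemma D_mxD i p q (M N : 'M[A]_(p, q)) : 'D[i](M + N) = 'D[i] M + 'D[i] N.
Proof. exact: map_mxD. Qed.
Lemma D_mxN i p q (M : 'M[A]_(p, q)) : 'D[i](- M) = - 'D[i] M.
Proof. exact: map_mxN. Qed.
Lemma D_trmx i p q (M : 'M[A]_(p, q)) : 'D[i](M^T) = ('D[i] M)^T.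
Proof. by rewrite map_trmx. Qed.

(** Row vectors v are differentiated by v |-> D_k v + v Gam_k, whence the order of
    the factors. *)
Definition curv m (Gam : 'I_n -> 'M[A]_m) i j : 'M[A]_m :=
  'D[i](Gam j) - 'D[j](Gam i) + Gam j *m Gam i - Gam i *m Gam j.

Section Connection.
Variables (m : nat) (Gam : 'I_n -> 'M[A]_m).

Lemma curv_anti i j : curv Gam j i = - curv Gam i j.
Proof. by rewrite /curv; mxzmod. Qed.

(** The second derivatives cancel because the derivations commute, the cubic terms
    in cyclic pairs. *)
Lemma differential_bianchi i j k :
  ('D[k](curv Gam i j) + curv Gam i j *m Gam k - Gam k *m curv Gam i j)
  + ('D[i](curv Gam j k) + curv Gam j k *m Gam i - Gam i *m curv Gam j k)
  + ('D[j](curv Gam k i) + curv Gam k i *m Gam j - Gam j *m curv Gam k i) = 0.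
Proof.
rewrite /curv !(D_mxD, D_mxN, D_mulmx, mulmxDl, mulmxDr, mulmxN, mulNmx) !mulmxA.
rewrite (D_commx k i) (D_commx i j) (D_commx j k).
by apply/matrixP => s t; rewrite !(mxDE, mxNE) [RHS]mxE; ring.
Qed.

(** Compare both sides of D_i D_j E = D_j D_i E.  For an invertible E this is the
    change of frame; for E = J and a = Gam it says that the curvature commutes with
    a parallel J. *)
Lemma curv_gauge (p : nat) (a : 'I_n -> 'M[A]_p) (E : 'M[A]_(p, m)) i j :
  (forall k, 'D[k] E = a k *m E - E *m Gam k) ->
  curv a i j *m E = E *m curv Gam i j.
Proof.
move=> DE; have := D_commx i j E; rewrite (DE i) (DE j).
rewrite !(D_mxD, D_mxN, D_mulmx) (DE i) (DE j) /curv.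
rewrite !(mulmxDl, mulmxDr, mulmxN, mulNmx) !mulmxA => H.
apply/matrixP => s t; move/matrixP/(_ s t): H; rewrite !(mxDE, mxNE) => H.
apply/eqP; rewrite -subr_eq0; apply/eqP.
move/eqP: H; rewrite -subr_eq0 => /eqP <-; ring.
Qed.

(** Again from D_i D_j G = D_j D_i G, now for the metric. *)
Lemma curv_skew (G : 'M[A]_m) i j :
  (forall k, 'D[k] G = Gam k *m G + G *m (Gam k)^T) ->
  curv Gam i j *m G + G *m (curv Gam i j)^T = 0.
Proof.
move=> DG; have := D_commx i j G; rewrite (DG i) (DG j).
rewrite !(D_mxD, D_mxN, D_mulmx) (DG i) (DG j) /curv.
rewrite !(D_trmx, mx_trD, mx_trN, trmx_mul).
rewrite !(mulmxDl, mulmxDr, mulmxN, mulNmx) !mulmxA => H.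
apply/matrixP => s t; move/matrixP/(_ s t): H; rewrite !(mxDE, mxNE) => H; rewrite [RHS]mxE.
move/eqP: H; rewrite -subr_eq0 => /eqP <-; ring.
Qed.

End Connection.

Lemma algebraic_bianchi (Gam : 'I_n -> 'M[A]_n) i j k l :
  (forall i j l, Gam i j l = Gam j i l) ->
  curv Gam i j k l + curv Gam j k i l + curv Gam k i j l = 0.
Proof.
move=> tf; rewrite /curv !(mxDE, mxNE) !mxE.
have E a b c : \sum_s Gam a c s * Gam b s l = \sum_s Gam c a s * Gam b s l.
  by apply: eq_bigr => s _; rewrite tf.
rewrite (E j i k) (E k j i) (E i k j) (tf k j l) (tf k i l) (tf j i l).
ring.
Qed.

Section Frame.
Variables (Gam : 'I_n -> 'M[A]_n) (E F : 'M[A]_n).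
Hypothesis torsion_free : forall i j l, Gam i j l = Gam j i l.
Hypothesis EF : E *m F = 1%:M.
Hypothesis FE : F *m E = 1%:M.
Implicit Types (al be ga de : 'I_n) (f : A).

(** Row i of [conn k] is the covariant derivative along the k-th coordinate of
    the i-th frame vector, expressed in the frame. *)
Definition conn k : 'M[A]_n := ('D[k] E + E *m Gam k) *m F.

Lemma D_frame k : 'D[k] E = conn k *m E - E *m Gam k.
Proof. by rewrite /conn -mulmxA FE mulmx1 addrK. Qed.

Definition frame_deriv al f : A := \sum_i E al i * D i f.
Definition contract1 (phi : 'I_n -> A) al : A := \sum_i E al i * phi i.
Definition contract2 (psi : 'I_n -> 'I_n -> A) al be : A :=
  \sum_i \sum_j E al i * E be j * psi i j.
Definition frame_conn al be ga : A := contract1 (fun k => conn k be ga) al.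
(** The connection is torsion-free, so these are the structure functions of the
    frame. *)
Definition frame_bracket al be ga : A := frame_conn al be ga - frame_conn be al ga.

Lemma frame_deriv_is_additive al : {morph frame_deriv al : f g / f - g}.
Proof.
move=> f g; rewrite /frame_deriv -sumrB; apply: eq_bigr => i _.
by rewrite raddfB mulrBr.
Qed.
HB.instance Definition _ al := GRing.isAdditive.Build A A (frame_deriv al) (frame_deriv_is_additive al).

Lemma frame_derivM al f g : frame_deriv al (f * g) = frame_deriv al f * g + f * frame_deriv al g.
Proof.
rewrite /frame_deriv mulr_suml mulr_sumr -big_split /=; apply: eq_bigr => i _.
rewrite DM; ring.
Qed.

(** Symmetric in [al] and [be], so that it drops out of brackets. *)
Let S al be j : A := \sum_i \sum_k E al i * E be k * Gam i k j.

Let S_sym al be j : S al be j = S be al j.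
Proof.
rewrite /S exchange_big /=; apply: eq_bigr => i _; apply: eq_bigr => k _.
rewrite torsion_free; ring.
Qed.

Lemma frame_deriv_frame al be j :
  frame_deriv al (E be j) = \sum_ga frame_conn al be ga * E ga j - S al be j.
Proof.
have -> : frame_deriv al (E be j) = \sum_i E al i * (conn i *m E - E *m Gam i) be j.
  by apply: eq_bigr => i _; rewrite -D_frame mxE.
under eq_bigr => i _ do rewrite !(mxDE, mxNE) mulrBr !mxE.
rewrite sumrB; congr (_ - _).
  under eq_bigr => i _ do rewrite mulr_sumr.
  rewrite exchange_big; apply: eq_bigr => ga _.
  by rewrite /frame_conn /contract1 mulr_suml; apply: eq_bigr => i _; rewrite mulrA.
by apply: eq_bigr => i _; rewrite mulr_sumr; apply: eq_bigr => k _; rewrite mulrA.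
Qed.

Lemma frame_deriv_contract1 phi al be :
  frame_deriv al (contract1 phi be) = \sum_ga frame_conn al be ga * contract1 phi ga
    - \sum_j S al be j * phi j + contract2 (fun i j => D i (phi j)) al be.
Proof.
rewrite {1}/contract1 raddf_sum /=.
under eq_bigr => j _ do rewrite frame_derivM frame_deriv_frame mulrDl.
rewrite !big_split /=; congr (_ + _ + _).
- under eq_bigr => j _ do rewrite mulr_suml.
  rewrite exchange_big; apply: eq_bigr => ga _.
  by rewrite /contract1 mulr_sumr; apply: eq_bigr => j _; rewrite mulrA.
- by rewrite -sumrN; apply: eq_bigr => j _; rewrite mulNr.
- rewrite /contract2 exchange_big; apply: eq_bigr => j _.
  by rewrite /frame_deriv mulr_sumr; apply: eq_bigr => i _; ring.
Qed.

(** Both sides evaluate the exterior derivative of phi on two frame vectors. *)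
Lemma frame_ext_deriv1 phi al be :
  frame_deriv al (contract1 phi be) - frame_deriv be (contract1 phi al) - \sum_ga frame_bracket al be ga * contract1 phi ga
  = contract2 (fun i j => D i (phi j) - D j (phi i)) al be.
Proof.
have -> : contract2 (fun i j => D i (phi j) - D j (phi i)) al be =
    contract2 (fun i j => D i (phi j)) al be - contract2 (fun i j => D i (phi j)) be al.
  rewrite [X in _ - X]exchange_big /= -sumrB; apply: eq_bigr => i _.
  by rewrite -sumrB; apply: eq_bigr => j _; ring.
have -> : \sum_ga frame_bracket al be ga * contract1 phi ga =
    \sum_ga frame_conn al be ga * contract1 phi ga - \sum_ga frame_conn be al ga * contract1 phi ga.
  by rewrite -sumrB; apply: eq_bigr => ga _; rewrite mulrBl.
rewrite !frame_deriv_contract1.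
under [\sum_j S be al j * _]eq_bigr => j _ do rewrite S_sym.
ring.
Qed.

Lemma frame_deriv_comm al be f :
  frame_deriv al (frame_deriv be f) - frame_deriv be (frame_deriv al f) = \sum_ga frame_bracket al be ga * frame_deriv ga f.
Proof.
apply/eqP; rewrite -subr_eq0; apply/eqP.
rewrite [LHS](frame_ext_deriv1 (fun i => D i f) al be).
by rewrite /contract2 big1 // => i _; rewrite big1 // => j _; rewrite D_comm subrr mulr0.
Qed.

Lemma contract2_anti psi al be : (forall i j, psi j i = - psi i j) ->
  contract2 psi be al = - contract2 psi al be.
Proof.
move=> anti; rewrite /contract2 exchange_big -sumrN; apply: eq_bigr => i _.
rewrite -sumrN; apply: eq_bigr => j _; rewrite anti; ring.
Qed.

Definition contract3 (chi : 'I_n -> 'I_n -> 'I_n -> A) al be ga : A :=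
  \sum_i \sum_j \sum_k E al i * E be j * E ga k * chi i j k.

Lemma contract3_rot chi al be ga :
  contract3 (fun i j k => chi j k i) al be ga = contract3 chi be ga al.
Proof.
rewrite /contract3 [RHS]exchange_big3; apply: eq_bigr => i _.
apply: eq_bigr => j _; apply: eq_bigr => k _; ring.
Qed.

Lemma frame_deriv_contract2 psi ga al be : (forall i j, psi j i = - psi i j) ->
  frame_deriv ga (contract2 psi al be) =
    (\sum_de frame_conn ga al de * contract2 psi de be
       - \sum_j S ga al j * contract1 (psi j) be)
    - (\sum_de frame_conn ga be de * contract2 psi de al
       - \sum_j S ga be j * contract1 (psi j) al)
    + contract3 (fun k i j => D k (psi i j)) ga al be.
Proof.
move=> anti.
have part1 a b : \sum_i \sum_j frame_deriv ga (E a i) * E b j * psi i j =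
    \sum_de frame_conn ga a de * contract2 psi de b - \sum_j S ga a j * contract1 (psi j) b.
  have -> : \sum_i \sum_j frame_deriv ga (E a i) * E b j * psi i j =
      \sum_i frame_deriv ga (E a i) * contract1 (psi i) b.
    apply: eq_bigr => i _; rewrite /contract1 mulr_sumr.
    by apply: eq_bigr => j _; rewrite mulrA.
  under eq_bigr => i _ do rewrite frame_deriv_frame mulrBl.
  rewrite sumrB; congr (_ - _).
  under eq_bigr => i _ do rewrite mulr_suml.
  rewrite exchange_big; apply: eq_bigr => de _.
  rewrite /contract2 mulr_sumr; apply: eq_bigr => i _.
  rewrite /contract1 mulr_sumr mulr_sumr; apply: eq_bigr => j _; ring.
rewrite -!part1 {1}/contract2 raddf_sum /=.
under eq_bigr => i _ do rewrite raddf_sum /=.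
have -> : \sum_i \sum_j frame_deriv ga (E be i) * E al j * psi i j =
   - \sum_i \sum_j E al i * frame_deriv ga (E be j) * psi i j.
  rewrite exchange_big -sumrN; apply: eq_bigr => i _.
  rewrite -sumrN; apply: eq_bigr => j _; rewrite anti; ring.
have -> : contract3 (fun k i j => D k (psi i j)) ga al be =
    \sum_i \sum_j E al i * E be j * frame_deriv ga (psi i j).
  rewrite /contract3 exchange_big; apply: eq_bigr => i _.
  rewrite exchange_big; apply: eq_bigr => j _.
  by rewrite /frame_deriv mulr_sumr; apply: eq_bigr => k _; ring.
rewrite opprK -!big_split; apply: eq_bigr => i _.
rewrite -!big_split; apply: eq_bigr => j _ /=.
rewrite !frame_derivM; ring.
Qed.

(** Both sides evaluate the exterior derivative of psi on three frame vectors. *)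
Lemma frame_ext_deriv2 psi al be ga : (forall i j, psi j i = - psi i j) ->
  let dpsi a b c :=
    frame_deriv c (contract2 psi a b) - \sum_de frame_bracket c a de * contract2 psi de b in
  dpsi al be ga + dpsi be ga al + dpsi ga al be =
  contract3 (fun k i j => D k (psi i j) + D i (psi j k) + D j (psi k i)) ga al be.
Proof.
move=> anti; rewrite /=.
have bracketE a b c : \sum_de frame_bracket c a de * contract2 psi de b =
    \sum_de frame_conn c a de * contract2 psi de b - \sum_de frame_conn a c de * contract2 psi de b.
  by rewrite -sumrB; apply: eq_bigr => de _; rewrite mulrBl.
rewrite !bracketE !frame_deriv_contract2//.
have SE a b c : \sum_j S a b j * contract1 (psi j) c = \sum_j S b a j * contract1 (psi j) c.
  by apply: eq_bigr => j _; rewrite S_sym.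
rewrite (SE ga be) (SE al ga) (SE be al).
have -> : contract3 (fun k i j => D k (psi i j) + D i (psi j k) + D j (psi k i)) ga al be
    = contract3 (fun k i j => D k (psi i j)) ga al be
    + contract3 (fun k i j => D k (psi i j)) al be ga
    + contract3 (fun k i j => D k (psi i j)) be ga al.
  set chi := fun k i j => D k (psi i j).
  rewrite -(contract3_rot chi ga al be) -(contract3_rot chi al be ga) -(contract3_rot _ ga al be).
  rewrite /contract3 -!big_split; apply: eq_bigr => i _; rewrite -!big_split.
  apply: eq_bigr => j _; rewrite -!big_split; apply: eq_bigr => k _ /=; ring.
ring.
Qed.

Lemma contract2D psi psi' al be :
  contract2 (fun i j => psi i j + psi' i j) al be = contract2 psi al be + contract2 psi' al be.
Proof.
rewrite /contract2 -big_split; apply: eq_bigr => i _; rewrite -big_split.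
by apply: eq_bigr => j _; rewrite mulrDr.
Qed.

Lemma contract2_sum (psi : 'I_n -> 'I_n -> 'I_n -> A) al be :
  contract2 (fun i j => \sum_m psi m i j) al be = \sum_m contract2 (psi m) al be.
Proof.
rewrite /contract2 [RHS]exchange_big; apply: eq_bigr => i _.
by rewrite [RHS]exchange_big; apply: eq_bigr => j _; rewrite mulr_sumr.
Qed.

Lemma eq_contract2 psi psi' al be : (forall i j, psi i j = psi' i j) ->
  contract2 psi al be = contract2 psi' al be.
Proof. by move=> e; apply: eq_bigr => i _; apply: eq_bigr => j _; rewrite e. Qed.

Lemma contract2_tensor phi phi' al be :
  contract2 (fun i j => phi i * phi' j) al be = contract1 phi al * contract1 phi' be.
Proof.
rewrite /contract1 mulr_suml; apply: eq_bigr => i _.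
by rewrite mulr_sumr; apply: eq_bigr => j _; ring.
Qed.

Definition frame_curv al be c d : A := contract2 (fun i j => curv conn i j c d) al be.

(** The curvature is the exterior derivative of the connection form plus its
    wedge square. *)
Lemma frame_curvE al be c d : frame_curv al be c d =
  frame_deriv al (frame_conn be c d) - frame_deriv be (frame_conn al c d) - \sum_ga frame_bracket al be ga * frame_conn ga c d
  + \sum_m (frame_conn be c m * frame_conn al m d - frame_conn al c m * frame_conn be m d).
Proof.
rewrite [X in X + _](frame_ext_deriv1 (fun k => conn k c d) al be).
transitivity (contract2 (fun i j => (D i (conn j c d) - D j (conn i c d)) +
    \sum_m (conn i m d * conn j c m + (- conn i c m) * conn j m d)) al be).
  apply: eq_contract2 => i j; rewrite /curv !(mxDE, mxNE) -addrA; congr (_ + _).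
    by rewrite !mxE.
  rewrite !mxE -sumrN -big_split; apply: eq_bigr => m _ /=; ring.
rewrite contract2D; congr (_ + _); rewrite contract2_sum; apply: eq_bigr => m _.
rewrite contract2D !contract2_tensor /frame_conn.
have -> : contract1 (fun i => - conn i c m) al = - contract1 (fun i => conn i c m) al.
  by rewrite /contract1 -sumrN; apply: eq_bigr => i _; rewrite mulrN.
ring.
Qed.

Lemma frame_differential_bianchi al be ga p q :
  let db a b c := frame_deriv c (frame_curv a b p q)
    - \sum_de frame_bracket c a de * frame_curv de b p q
    + \sum_m (frame_curv a b p m * frame_conn c m q - frame_conn c p m * frame_curv a b m q) in
  db al be ga + db be ga al + db ga al be = 0.
Proof.
pose br i j k := \sum_m (curv conn i j p m * conn k m q - conn k p m * curv conn i j m q).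
pose Y a b c := \sum_m (frame_curv a b p m * frame_conn c m q
                        - frame_conn c p m * frame_curv a b m q).
have YE a b c : contract3 (fun k i j => br i j k) c a b = Y a b c.
  rewrite /contract3 /br; under eq_bigr => k _ do under eq_bigr => i _ do
    under eq_bigr => j _ do rewrite mulr_sumr.
  under eq_bigr => k _ do under eq_bigr => i _ do rewrite exchange_big.
  under eq_bigr => k _ do rewrite exchange_big.
  rewrite exchange_big; apply: eq_bigr => m _.
  rewrite [X in X - _]mulrC /frame_conn /contract1 !mulr_suml -sumrB; apply: eq_bigr => k _.
  rewrite /frame_curv /contract2 !mulr_sumr -sumrB; apply: eq_bigr => i _.
  rewrite !mulr_sumr -sumrB; apply: eq_bigr => j _; ring.
pose X a b c := frame_deriv c (frame_curv a b p q)
  - \sum_de frame_bracket c a de * frame_curv de b p q.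
have XE : X al be ga + X be ga al + X ga al be =
    contract3 (fun k i j => D k (curv conn i j p q) + D i (curv conn j k p q)
                       + D j (curv conn k i p q)) ga al be.
  apply: (@frame_ext_deriv2 (fun i j => curv conn i j p q) al be ga).
  by move=> i j; rewrite curv_anti mxNE.
rewrite /= -/(X al be ga) -/(X be ga al) -/(X ga al be).
rewrite -/(Y al be ga) -/(Y be ga al) -/(Y ga al be).
transitivity (X al be ga + X be ga al + X ga al be + (Y al be ga + Y be ga al + Y ga al be)).
  by ring.
rewrite {}XE -!YE; set chi := fun k i j => br i j k.
rewrite -(contract3_rot chi ga al be) -(contract3_rot chi al be ga) -(contract3_rot _ ga al be).
rewrite /contract3 -!big_split big1 // => i _; rewrite -!big_split big1 // => j _.
rewrite -!big_split big1 // => k _ /=; rewrite -!mulrDr.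
rewrite [X in _ * X](_ : _ = 0) ?mulr0 //.
have := congr1 (fun M : 'M[A]_n => M p q) (differential_bianchi conn j k i).
rewrite !(mxDE, mxNE) ![map_mx _ _ _ _]mxE [fun_of_matrix 0 p q]mxE => bianchi.
have brE a b c : br a b c = (curv conn a b *m conn c) p q - (conn c *m curv conn a b) p q.
  by rewrite !mxE -sumrB.
rewrite /chi !brE -bianchi /curv !(mxDE, mxNE) ![map_mx _ _ _ _]mxE; ring.
Qed.

End Frame.

End DifferentialRing.

Lemma curvE n (A : comPzRingType) (D : 'I_n -> {additive A -> A}) m
    (Gam : 'I_n -> 'M[A]_m) i j s t :
  curv D Gam i j s t = D i (Gam j s t) - D j (Gam i s t)
    + \sum_u Gam j s u * Gam i u t - \sum_u Gam i s u * Gam j u t.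
Proof. by rewrite !mxE. Qed.

Lemma rmorph_curv n (A B : comPzRingType) (D : 'I_n -> {additive A -> A})
    (f : {rmorphism A -> B}) m (Gam : 'I_n -> 'M[A]_m) i j s t :
  f (curv D Gam i j s t) = f (D i (Gam j s t)) - f (D j (Gam i s t))
    + \sum_u (f (Gam i u t) * f (Gam j s u) - f (Gam j u t) * f (Gam i s u)).
Proof.
rewrite curvE rmorphB rmorphD rmorphB !rmorph_sum sumrB addrA.
by congr (_ + _ - _); apply: eq_bigr => u _; rewrite rmorphM mulrC.
Qed.

(** * Self-dual forms and determinants in dimension four *)

Notation o0 := (@Ordinal 4 0 isT).
Notation o1 := (@Ordinal 4 1 isT).
Notation o2 := (@Ordinal 4 2 isT).
Notation o3 := (@Ordinal 4 3 isT).

Lemma ord4_ind (P : 'I_4 -> Prop) : P o0 -> P o1 -> P o2 -> P o3 -> forall i, P i.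
Proof.
move=> P0 P1 P2 P3 [[|[|[|[|//]]]] h].
- by rewrite (_ : Ordinal h = o0) //; apply: val_inj.
- by rewrite (_ : Ordinal h = o1) //; apply: val_inj.
- by rewrite (_ : Ordinal h = o2) //; apply: val_inj.
- by rewrite (_ : Ordinal h = o3) //; apply: val_inj.
Qed.

Lemma sum4 (K : nmodType) (f : 'I_4 -> K) :
  \sum_i f i = f o0 + f o1 + f o2 + f o3.
Proof.
rewrite !big_ord_recr big_ord0 /= add0r.
by congr (f _ + f _ + f _ + f _); apply: val_inj.
Qed.

Definition mx4 (K : Type) (z : K) (s : seq (seq K)) : 'M[K]_4 :=
  \matrix_(i, j) nth z (nth [::] s i) j.

Section Quaternion.
Variable K : pzRingType.

Definition J1 : 'M[K]_4 :=
  mx4 0 [:: [:: 0; 1; 0; 0]; [:: -1; 0; 0; 0]; [:: 0; 0; 0; 1]; [:: 0; 0; -1; 0]].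
Definition J2 : 'M[K]_4 :=
  mx4 0 [:: [:: 0; 0; 1; 0]; [:: 0; 0; 0; -1]; [:: -1; 0; 0; 0]; [:: 0; 1; 0; 0]].
Definition J3 : 'M[K]_4 :=
  mx4 0 [:: [:: 0; 0; 0; 1]; [:: 0; 0; 1; 0]; [:: 0; -1; 0; 0]; [:: -1; 0; 0; 0]].

(** The components of a skew matrix along the three self-dual forms [J1],
    [J2], [J3], up to a common factor. *)
Definition sd1 (M : 'M[K]_4) := M o0 o1 + M o2 o3.
Definition sd2 (M : 'M[K]_4) := M o0 o2 - M o1 o3.
Definition sd3 (M : 'M[K]_4) := M o0 o3 + M o1 o2.

End Quaternion.
Arguments J1 {K}. Arguments J2 {K}. Arguments J3 {K}.

Section Det4.
Variable K : comPzRingType.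

Lemma det4E (M : 'M[K]_4) :
  let a i j := M i j in
  \det M =
    (a o0 o0 * a o1 o1 - a o0 o1 * a o1 o0) * (a o2 o2 * a o3 o3 - a o2 o3 * a o3 o2)
  - (a o0 o0 * a o1 o2 - a o0 o2 * a o1 o0) * (a o2 o1 * a o3 o3 - a o2 o3 * a o3 o1)
  + (a o0 o0 * a o1 o3 - a o0 o3 * a o1 o0) * (a o2 o1 * a o3 o2 - a o2 o2 * a o3 o1)
  + (a o0 o1 * a o1 o2 - a o0 o2 * a o1 o1) * (a o2 o0 * a o3 o3 - a o2 o3 * a o3 o0)
  - (a o0 o1 * a o1 o3 - a o0 o3 * a o1 o1) * (a o2 o0 * a o3 o2 - a o2 o2 * a o3 o0)
  + (a o0 o2 * a o1 o3 - a o0 o3 * a o1 o2) * (a o2 o0 * a o3 o1 - a o2 o1 * a o3 o0).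
Proof.
move=> a; rewrite {}/a.
pose m i j := M (inord i) (inord j).
have mE i j : M i j = m i j by rewrite /m !inord_val.
rewrite (expand_det_row _ ord0) !big_ord_recr big_ord0 /= /cofactor.
rewrite !(expand_det_row _ ord0) !big_ord_recr !big_ord0 /= /cofactor.
rewrite !(expand_det_row _ ord0) !big_ord_recr !big_ord0 /= /cofactor.
rewrite !det_mx11 !mxE !mE.
rewrite /= /bump /=.
rewrite !(add0n, addn0, add1n, addn1, addnS, addSn) !exprS expr0; ring.
Qed.

End Det4.

Section Contraction.
Variables (K : comPzRingType) (n : nat) (E : 'M[K]_n).
Implicit Types (al be ga de : 'I_n) (T : 'I_n -> 'I_n -> 'I_n -> 'I_n -> K).

Definition contract4 T al be ga de : K :=
  \sum_i \sum_j \sum_k \sum_l E al i * E be j * E ga k * E de l * T i j k l.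

Lemma contract4_swap12 T al be ga de :
  contract4 T be al ga de = contract4 (fun i j => T j i) al be ga de.
Proof.
rewrite /contract4 exchange_big; apply: eq_bigr => i _; apply: eq_bigr => j _.
apply: eq_bigr => k _; apply: eq_bigr => l _; ring.
Qed.

Lemma contract4_swap23 T al be ga de :
  contract4 T al ga be de = contract4 (fun i j k => T i k j) al be ga de.
Proof.
apply: eq_bigr => i _; rewrite exchange_big; apply: eq_bigr => j _.
apply: eq_bigr => k _; apply: eq_bigr => l _; ring.
Qed.

Lemma contract4_swap34 T al be ga de :
  contract4 T al be de ga = contract4 (fun i j k l => T i j l k) al be ga de.
Proof.
apply: eq_bigr => i _; apply: eq_bigr => j _; rewrite exchange_big.
apply: eq_bigr => k _; apply: eq_bigr => l _; ring.
Qed.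

Lemma eq_contract4 T T' al be ga de : (forall i j k l, T i j k l = T' i j k l) ->
  contract4 T al be ga de = contract4 T' al be ga de.
Proof.
move=> TT; apply: eq_bigr => i _; apply: eq_bigr => j _.
by apply: eq_bigr => k _; apply: eq_bigr => l _; rewrite TT.
Qed.

Lemma contract4_lin T T' (a : K) al be ga de :
  contract4 (fun i j k l => a * T i j k l + T' i j k l) al be ga de =
  a * contract4 T al be ga de + contract4 T' al be ga de.
Proof.
rewrite /contract4; do 4! (rewrite mulr_sumr -big_split; apply: eq_bigr => ? _).
rewrite /=; ring.
Qed.

Lemma contract4_0 al be ga de : contract4 (fun _ _ _ _ => 0) al be ga de = 0.
Proof. by rewrite /contract4; do 4! (rewrite big1 // => ? _); rewrite mulr0. Qed.

Lemma congr_mxE (M : 'M[K]_n) al be :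
  (E *m M *m E^T) al be = \sum_i \sum_j E al i * E be j * M i j.
Proof.
rewrite mxE exchange_big; apply: eq_bigr => j _.
rewrite mxE mulr_suml; apply: eq_bigr => i _; rewrite !mxE; ring.
Qed.

Lemma contract4_tensor (M N : 'M[K]_n) al be ga de :
  contract4 (fun i j k l => M i j * N k l) al be ga de =
  (E *m M *m E^T) al be * (E *m N *m E^T) ga de.
Proof.
rewrite !congr_mxE mulr_suml; apply: eq_bigr => i _.
rewrite mulr_suml; apply: eq_bigr => j _.
rewrite mulr_sumr; apply: eq_bigr => k _.
rewrite mulr_sumr; apply: eq_bigr => l _; ring.
Qed.

Lemma contract4_matrix (T : 'I_n -> 'I_n -> 'M[K]_n) al be ga de :
  contract4 T al be ga de =
  \sum_i \sum_j E al i * E be j * (E *m T i j *m E^T) ga de.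
Proof.
apply: eq_bigr => i _; apply: eq_bigr => j _; rewrite congr_mxE mulr_sumr.
apply: eq_bigr => k _; rewrite mulr_sumr; apply: eq_bigr => l _; ring.
Qed.

(** In an orthonormal frame [E^T *m E] is the inverse metric, so that both sides
    are a trace over the first and last arguments. *)
Lemma contract4_trace (T : 'I_n -> 'I_n -> 'I_n -> 'I_n -> K) be ga :
  \sum_al contract4 T al be ga al =
  (E *m (\matrix_(j, k) \sum_i \sum_l (E^T *m E) i l * T i j k l) *m E^T) be ga.
Proof.
rewrite congr_mxE /contract4 exchange_big.
under eq_bigr => i _ do rewrite exchange_big.
rewrite exchange_big; apply: eq_bigr => j _.
under eq_bigr => i _ do (under eq_bigr => al _ do rewrite exchange_big).
under eq_bigr => i _ do rewrite exchange_big /=.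
under eq_bigr => i _ do (under eq_bigr => l _ do rewrite exchange_big).
under eq_bigr => i _ do rewrite exchange_big /=.
rewrite exchange_big; apply: eq_bigr => k _; rewrite mxE mulr_sumr.
apply: eq_bigr => i _; rewrite mulr_sumr; apply: eq_bigr => l _.
rewrite mxE mulr_suml mulr_sumr; apply: eq_bigr => al _.
rewrite mxE; ring.
Qed.

Lemma contract4_opp T T' al be ga de : (forall i j k l, T' i j k l = - T i j k l) ->
  contract4 T' al be ga de = - contract4 T al be ga de.
Proof.
move=> TT; rewrite (eq_contract4 (T' := fun i j k l => -1 * T i j k l + 0)).
  by rewrite contract4_lin contract4_0 mulN1r addr0.
by move=> i j k l; rewrite TT mulN1r addr0.
Qed.

Lemma contract4_anti12 T : (forall i j k l, T j i k l = - T i j k l) ->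
  forall a b c d, contract4 T b a c d = - contract4 T a b c d.
Proof. by move=> anti a b c d; rewrite contract4_swap12; exact: contract4_opp. Qed.

Lemma contract4_anti34 T : (forall i j k l, T i j l k = - T i j k l) ->
  forall a b c d, contract4 T a b d c = - contract4 T a b c d.
Proof. by move=> anti a b c d; rewrite contract4_swap34; exact: contract4_opp. Qed.

Lemma contract4_bianchi T :
  (forall i j k l, T i j k l + T j k i l + T k i j l = 0) ->
  forall a b c d, contract4 T a b c d + contract4 T b c a d + contract4 T c a b d = 0.
Proof.
move=> bianchi a b c d.
have -> : contract4 T b c a d = contract4 (fun i j k l => T j k i l) a b c d.
  by rewrite contract4_swap23 contract4_swap12.
have -> : contract4 T c a b d = contract4 (fun i j k l => T k i j l) a b c d.
  by rewrite contract4_swap12 contract4_swap23.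
rewrite -(contract4_0 a b c d).
transitivity (contract4 (fun i j k l => 1 * T i j k l +
    (1 * T j k i l + T k i j l)) a b c d).
  by rewrite !contract4_lin !mul1r addrA.
by apply: eq_contract4 => i j k l; rewrite !mul1r addrA bianchi.
Qed.

End Contraction.

Section HodgeStar.
Variable R : realType.
Implicit Types (E J : 'M[R]_4).

Lemma det_frame4_mul (u0 u1 u2 u3 : 'rV[R]_4) E :
  frame4 (u0 *m E) (u1 *m E) (u2 *m E) (u3 *m E) = frame4 u0 u1 u2 u3 *m E.
Proof.
apply/row_matrixP; apply: ord4_ind; rewrite row_mul !rowK //=.
Qed.

Lemma frame4_rows E : frame4 (row o0 E) (row o1 E) (row o2 E) (row o3 E) = E.
Proof. by apply/row_matrixP; apply: ord4_ind; rewrite !rowK. Qed.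

(** [J1] is multiplication by i on C^2, so this determinant is the squared
    modulus of a 2 x 2 complex determinant. *)
Lemma det_complex_frame (v w : 'rV[R]_4) :
  0 <= \det (frame4 v (v *m J1) w (w *m J1)).
Proof.
have -> : \det (frame4 v (v *m J1) w (w *m J1)) =
   (v 0 o0 * w 0 o2 - v 0 o1 * w 0 o3 - v 0 o2 * w 0 o0 + v 0 o3 * w 0 o1) ^+ 2
 + (v 0 o0 * w 0 o3 + v 0 o1 * w 0 o2 - v 0 o2 * w 0 o1 - v 0 o3 * w 0 o0) ^+ 2.
  rewrite det4E /frame4 /J1 /mx4 !mxE /= !sum4 !mxE /=; ring.
by rewrite addr_ge0 ?sqr_ge0.
Qed.

(** The frame (v, Jv, w, Jw) is the image under E of a frame of the same kind for
    [J1], whose determinant is nonnegative. *)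
Lemma orientationE E J : E *m J = J1 *m E -> E \in unitmx ->
  orientation J = Num.sg (\det E).
Proof.
move=> EJ uE; rewrite /orientation.
have sgE o : (exists v w : 'rV[R]_4,
    let d := \det (frame4 v (v *m J) w (w *m J)) in d != 0 /\ o = Num.sg d) ->
    o = Num.sg (\det E).
  case=> v [w] /=.
  have vE (x : 'rV[R]_4) : x *m J = (x *m invmx E *m J1) *m E.
    by rewrite -mulmxA -EJ mulmxA mulmxKV.
  rewrite !vE -{1 3}[v](mulmxKV uE) -{1 3}[w](mulmxKV uE) det_frame4_mul.
  rewrite det_mulmx mulf_eq0 negb_or sgrM => -[/andP[d0 _] ->].
  by rewrite [X in X * _]gtr0_sg ?mul1r // lt_def d0 det_complex_frame.
apply: xget_subset1.
  have JE i : row i E *m J = row i (J1 *m E) by rewrite -EJ row_mul.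
  have J1E0 : row o0 (J1 *m E) = row o1 E.
    by apply/rowP => j; rewrite /J1 /mx4 !mxE sum4 !mxE /=; ring.
  have J1E2 : row o2 (J1 *m E) = row o3 E.
    by apply/rowP => j; rewrite /J1 /mx4 !mxE sum4 !mxE /=; ring.
  exists (row o0 E), (row o2 E); rewrite /= !JE J1E0 J1E2 frame4_rows.
  by split=> //; rewrite -unitfE -unitmxE.
by move=> a b /sgE -> /sgE ->.
Qed.

Lemma row_functionalE (f : 'rV[R]_4 -> R) :
  (forall a u v, f (a *: u + v) = a * f u + f v) ->
  forall u, f u = \sum_p u 0 p * f (delta_mx 0 p).
Proof.
move=> lf u; rewrite {1}(row_sum_delta u) !sum4.
have f0 : f 0 = 0.
  have := lf 1 0 0; rewrite scale1r addr0 mul1r => /eqP.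
  by rewrite -subr_eq0 opprD addNKr oppr_eq0 => /eqP.
by rewrite -!addrA !lf -[_ *: delta_mx 0 o3]addr0 lf f0 addr0.
Qed.

Lemma det_frame4_expand (u0 u1 u2 u3 : 'rV[R]_4) :
  \det (frame4 u0 u1 u2 u3) =
  \sum_p \sum_q \sum_s \sum_t u0 0 p * u1 0 q * u2 0 s * u3 0 t *
    \det (frame4 (delta_mx 0 p) (delta_mx 0 q) (delta_mx 0 s) (delta_mx 0 t)).
Proof.
have l0 v1 v2 v3 := @row_functionalE (fun v => \det (frame4 v v1 v2 v3)).
have l1 v1 v2 v3 := @row_functionalE (fun v => \det (frame4 v1 v v2 v3)).
have l2 v1 v2 v3 := @row_functionalE (fun v => \det (frame4 v1 v2 v v3)).
have l3 v1 v2 v3 := @row_functionalE (fun v => \det (frame4 v1 v2 v3 v)).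
rewrite l0; last by move=> a u v; rewrite !det4E !mxE /= ?mxE; ring.
apply: eq_bigr => p _.
rewrite l1 ?mulr_sumr; last by move=> a u v; rewrite !det4E !mxE /= ?mxE; ring.
apply: eq_bigr => q _.
rewrite l2 ?mulr_sumr; last by move=> a u v; rewrite !det4E !mxE /= ?mxE; ring.
apply: eq_bigr => s _.
rewrite l3 ?mulr_sumr; last by move=> a u v; rewrite !det4E !mxE /= ?mxE; ring.
by apply: eq_bigr => t _; rewrite !mulrA.
Qed.

Lemma contract4_det_frame4 E al be ga de :
  contract4 E (fun p q s t =>
    \det (frame4 (delta_mx 0 p) (delta_mx 0 q) (delta_mx 0 s) (delta_mx 0 t)))
    al be ga de =
  \det (frame4 (delta_mx 0 al) (delta_mx 0 be) (delta_mx 0 ga) (delta_mx 0 de))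
  * \det E.
Proof.
rewrite -det_mulmx -det_frame4_mul -!rowE det_frame4_expand.
do 4! (apply: eq_bigr => ? _); by rewrite !mxE.
Qed.

End HodgeStar.

Lemma exchange_big22 n (K : nmodType) (f : 'I_n -> 'I_n -> 'I_n -> 'I_n -> K) :
  \sum_i \sum_j \sum_k \sum_l f i j k l = \sum_k \sum_l \sum_i \sum_j f i j k l.
Proof.
under eq_bigr => i _ do rewrite exchange_big.
rewrite exchange_big; apply: eq_bigr => k _.
under eq_bigr => i _ do rewrite exchange_big.
by rewrite exchange_big.
Qed.

Section PointwiseFrame.
Variables (R : realType) (G J E : 'M[R]_4).
Hypothesis EGE : E *m G *m E^T = 1%:M.
Hypothesis EJ : E *m J = J1 *m E.

Lemma frame_unit : E \in unitmx.
Proof. by have := mulmx1_unit EGE; rewrite unitmx_mul => -[/andP[]]. Qed.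

Lemma frame_metric_inv : invmx G = E^T *m E.
Proof.
have H : G *m (E^T *m E) = 1%:M.
  by rewrite mulmxA; apply: mulmx1C; rewrite mulmxA.
have [uG _] := mulmx1_unit H.
by rewrite -[LHS]mulmx1 -H mulKmx.
Qed.

Lemma frame_volume : orientation J * Num.sqrt (\det G) * \det E = 1.
Proof.
rewrite (orientationE EJ frame_unit) mulrAC -normrEsg -sqrtr_sqr -sqrtrM ?sqr_ge0//.
rewrite -[RHS]sqrtr1; congr Num.sqrt.
have := congr1 determinant EGE; rewrite !det_mulmx det_tr det1 => <-; ring.
Qed.

Let vol p q s t : R :=
  \det (frame4 (delta_mx 0 p) (delta_mx 0 q) (delta_mx 0 s) (delta_mx 0 t)).

Lemma hodge_star_frame (al : 'M[R]_4) a b :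
  (E *m hodge_star G J al *m E^T) a b =
  2^-1 * \sum_p \sum_q (E *m al *m E^T) p q * vol p q a b.
Proof.
set be := E *m al *m E^T.
pose c := orientation J * Num.sqrt (\det G).
have -> : hodge_star G J al = \matrix_(s, t) (2^-1 * \sum_p \sum_q
    (E^T *m be *m E^T^T) p q * (c * vol p q s t)).
  apply/matrixP => s t; rewrite !mxE; congr (_ * _).
  apply: eq_bigr => p _; apply: eq_bigr => q _; congr (_ * _).
  by rewrite frame_metric_inv /be trmxK !mulmxA.
have -> : \sum_p \sum_q be p q * vol p q a b =
    \sum_p \sum_q be p q * (c * contract4 E vol p q a b).
  apply: eq_bigr => p _; apply: eq_bigr => q _; congr (_ * _).
  by rewrite contract4_det_frame4 -/(vol p q a b) mulrCA frame_volume mulr1.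
rewrite congr_mxE.
under eq_bigr => s _ do under eq_bigr => t _ do rewrite mxE mulrCA mulr_sumr.
under eq_bigr => s _ do rewrite -mulr_sumr.
rewrite -mulr_sumr; congr (_ * _).
under eq_bigr => s _ do under eq_bigr => t _ do
  under eq_bigr => p _ do rewrite mulr_sumr.
rewrite exchange_big22.
under eq_bigr => p _ do under eq_bigr => q _ do under eq_bigr => s _ do
  under eq_bigr => t _ do rewrite congr_mxE mulr_suml mulr_sumr.
transitivity (\sum_p \sum_q \sum_mu \sum_nu be mu nu * c *
    \sum_s \sum_t E mu p * E nu q * E a s * E b t * vol p q s t).
  apply: eq_bigr => p _; apply: eq_bigr => q _.
  under eq_bigr => s _ do under eq_bigr => t _ do
    under eq_bigr => mu _ do rewrite mulr_suml mulr_sumr.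
  rewrite exchange_big22; apply: eq_bigr => mu _; apply: eq_bigr => nu _.
  rewrite mulr_sumr; apply: eq_bigr => s _.
  rewrite mulr_sumr; apply: eq_bigr => t _; rewrite !mxE; ring.
rewrite exchange_big22; apply: eq_bigr => mu _; apply: eq_bigr => nu _.
rewrite mulrA /contract4 mulr_sumr; apply: eq_bigr => p _.
by rewrite mulr_sumr.
Qed.

(** In a compatible orthonormal frame the star exchanges e^01 with e^23, e^02 with
    e^31, and e^03 with e^12. *)
Lemma self_dual_part_eq0 (al : 'M[R]_4) :
  (forall i j, al j i = - al i j) -> self_dual_part G J al = 0 ->
  let be := E *m al *m E^T in [/\ sd1 be = 0, sd2 be = 0 & sd3 be = 0].
Proof.
move=> anti sd0 be.
have banti a b : be b a = - be a b.
  rewrite /be !congr_mxE exchange_big -sumrN; apply: eq_bigr => i _.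
  rewrite -sumrN; apply: eq_bigr => j _; rewrite anti; ring.
have H a b : be a b + 2^-1 * \sum_p \sum_q be p q * vol p q a b = 0.
  rewrite -hodge_star_frame -mxDE -mulmxDl -mulmxDr.
  move: sd0 => /(congr1 (fun M => 2%:R *: M)).
  rewrite /self_dual_part scalerA divff ?pnatr_eq0// scale1r scaler0 => ->.
  by rewrite mulmx0 mul0mx mxE.
have diag a : be a a = 0 by have := banti a a; lra.
have vol01 p q : vol p q o0 o1 = (p == o2)%:R * (q == o3)%:R - (p == o3)%:R * (q == o2)%:R.
  by rewrite /vol det4E /frame4 !mxE /= ?mxE /= !(eq_sym _ p) !(eq_sym _ q); ring.
have vol02 p q : vol p q o0 o2 = (p == o3)%:R * (q == o1)%:R - (p == o1)%:R * (q == o3)%:R.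
  by rewrite /vol det4E /frame4 !mxE /= ?mxE /= !(eq_sym _ p) !(eq_sym _ q); ring.
have vol03 p q : vol p q o0 o3 = (p == o1)%:R * (q == o2)%:R - (p == o2)%:R * (q == o1)%:R.
  by rewrite /vol det4E /frame4 !mxE /= ?mxE /= !(eq_sym _ p) !(eq_sym _ q); ring.
split; rewrite /sd1 /sd2 /sd3.
- have := H o0 o1; under eq_bigr => p _ do under eq_bigr => q _ do rewrite vol01.
  by rewrite !sum4 /=; have := banti o2 o3; lra.
- have := H o0 o2; under eq_bigr => p _ do under eq_bigr => q _ do rewrite vol02.
  by rewrite !sum4 /=; have := banti o1 o3; lra.
- have := H o0 o3; under eq_bigr => p _ do under eq_bigr => q _ do rewrite vol03.
  by rewrite !sum4 /=; have := banti o1 o2; lra.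
Qed.

End PointwiseFrame.

(** * The curvature of an anti-self-dual metric with J-invariant Ricci tensor *)

(** A signed sum of the four cyclic identities that differ in the index left in the
    last place. *)
Lemma pair_symmetry (R : realFieldType) (T : Type) (r : T -> T -> T -> T -> R) :
  (forall a b c d, r b a c d = - r a b c d) ->
  (forall a b c d, r a b d c = - r a b c d) ->
  (forall a b c d, r a b c d + r b c a d + r c a b d = 0) ->
  forall a b c d, r a b c d = r c d a b.
Proof.
move=> s1 s2 B a b c d.
have := B a b c d; have := B b c d a; have := B c d a b; have := B d a b c.
have := s1 c d a b; have := s1 b d a c; have := s1 c a b d; have := s1 b c a d.
have := s1 d a b c; have := s1 a b d c; have := s1 c d b a; have := s1 d b c a.
have := s1 a c d b; have := s1 c d a b.
have := s2 a b c d; have := s2 b c a d; have := s2 c a b d.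
have := s2 b c d a; have := s2 c d b a; have := s2 d b c a.
have := s2 c d a b; have := s2 d a c b; have := s2 a c d b; have := s2 d a b c.
have := s2 b d a c; have := s2 d b a c; have := s2 c a d b; have := s1 d b a c.
have := s1 a c b d; have := s1 a d b c; have := s2 a d b c.
lra.
Qed.

Lemma J1_invariant_sym (R : realFieldType) (M : 'M[R]_4) :
  (forall a b, M b a = M a b) -> J1 *m M *m J1^T = M ->
  [/\ M o1 o1 = M o0 o0, M o3 o3 = M o2 o2, M o0 o1 = 0, M o2 o3 = 0 &
      M o1 o3 = M o0 o2 /\ M o1 o2 = - M o0 o3].
Proof.
move=> sym MJ.
have MJE i j : \sum_p \sum_q J1 i p * J1 j q * M p q = M i j.
  by rewrite -congr_mxE MJ.
have := MJE o0 o0; have := MJE o0 o1; have := MJE o0 o2; have := MJE o0 o3.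
have := MJE o2 o2; have := MJE o2 o3.
have := sym o0 o1; have := sym o0 o2; have := sym o0 o3.
have := sym o1 o2; have := sym o1 o3; have := sym o2 o3.
clear; rewrite !sum4; move: (fun_of_matrix M) => m; rewrite /J1 /mx4 !mxE /=.
by move=> *; do 2?split; lra.
Qed.

Section AntiSelfDualCurvature.
Variables (R : realType) (G J E : 'M[R]_4).
Hypothesis EGE : E *m G *m E^T = 1%:M.
Hypothesis EJ : E *m J = J1 *m E.
Variable Rm : 'I_4 -> 'I_4 -> 'I_4 -> 'I_4 -> R.
Hypothesis Rm_anti12 : forall i j k l, Rm j i k l = - Rm i j k l.
Hypothesis Rm_anti34 : forall i j k l, Rm i j l k = - Rm i j k l.
Hypothesis Rm_bianchi : forall i j k l, Rm i j k l + Rm j k i l + Rm k i j l = 0.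

Definition ricci_of : 'M[R]_4 :=
  \matrix_(j, k) \sum_i \sum_l (invmx G) i l * Rm i j k l.
Definition scalar_of : R := \sum_j \sum_k invmx G j k * ricci_of j k.
Definition weyl_of i j k l : R :=
  Rm i j k l
  - 2^-1 * (ricci_of j k * G i l - ricci_of i k * G j l
            + G j k * ricci_of i l - G i k * ricci_of j l)
  + scalar_of / 6 * (G j k * G i l - G i k * G j l).

Hypothesis asd : forall k l, self_dual_part G J (\matrix_(a, b) weyl_of a b k l) = 0.
Hypothesis ricci_J : J *m ricci_of *m J^T = ricci_of.

Let r := contract4 E Rm.
Let w := contract4 E weyl_of.
Let rho : 'M[R]_4 := E *m ricci_of *m E^T.

Let r_anti12 a b c d : r b a c d = - r a b c d. Proof. exact: contract4_anti12. Qed.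
Let r_anti34 a b c d : r a b d c = - r a b c d. Proof. exact: contract4_anti34. Qed.
Let r_bianchi a b c d : r a b c d + r b c a d + r c a b d = 0.
Proof. exact: contract4_bianchi. Qed.

Let r_pair a b c d : r a b c d = r c d a b.
Proof. exact: (pair_symmetry r_anti12 r_anti34 r_bianchi). Qed.

Let rhoE b c : rho b c = \sum_a r a b c a.
Proof. by rewrite contract4_trace -(frame_metric_inv EGE). Qed.

Let rho_sym b c : rho c b = rho b c.
Proof.
by rewrite !rhoE; apply: eq_bigr => a _; rewrite r_pair r_anti12 r_anti34 opprK.
Qed.

Let rho_J : J1 *m rho *m J1^T = rho.
Proof.
rewrite /rho -[in RHS]ricci_J -!mulmxA -trmx_mul -EJ trmx_mul !mulmxA -EJ.
by rewrite -!mulmxA.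
Qed.

Let scalarE : scalar_of = \sum_a rho a a.
Proof.
rewrite /scalar_of (frame_metric_inv EGE).
under eq_bigr => j _ do under eq_bigr => k _ do rewrite mxE mulr_suml.
under eq_bigr => j _ do rewrite exchange_big.
rewrite exchange_big; apply: eq_bigr => a _; rewrite congr_mxE.
by apply: eq_bigr => j _; apply: eq_bigr => k _; rewrite mxE.
Qed.

Let contract4_tensor13 (M N : 'M[R]_4) a b c d :
  contract4 E (fun i j k l => M i k * N j l) a b c d =
  (E *m M *m E^T) a c * (E *m N *m E^T) b d.
Proof. by rewrite -contract4_tensor contract4_swap23. Qed.

Let contract4_tensor23 (M N : 'M[R]_4) a b c d :
  contract4 E (fun i j k l => M j k * N i l) a b c d =
  (E *m M *m E^T) b c * (E *m N *m E^T) a d.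
Proof. by rewrite -contract4_tensor13 contract4_swap12. Qed.

Let wE a b c d : w a b c d =
  r a b c d - 2^-1 * (rho b c * (a == d)%:R - rho a c * (b == d)%:R
                      + (b == c)%:R * rho a d - (a == c)%:R * rho b d)
  + scalar_of / 6 * ((b == c)%:R * (a == d)%:R - (a == c)%:R * (b == d)%:R).
Proof.
have T23 := contract4_tensor23; have T13 := contract4_tensor13.
pose q := scalar_of / 6.
transitivity (contract4 E (fun i j k l => (- 2^-1) * (ricci_of j k * G i l) +
   (2^-1 * (ricci_of i k * G j l) + ((- 2^-1) * (G j k * ricci_of i l) +
   (2^-1 * (G i k * ricci_of j l) + (q * (G j k * G i l) +
   ((- q) * (G i k * G j l) + Rm i j k l)))))) a b c d).
  by apply: eq_contract4 => i j k l; rewrite /weyl_of /q; ring.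
rewrite !contract4_lin !T23 !T13 EGE -/rho -/(r a b c d) !mxE /q; ring.
Qed.

Let w_sd c d : [/\ w o0 o1 c d + w o2 o3 c d = 0,
  w o0 o2 c d - w o1 o3 c d = 0 & w o0 o3 c d + w o1 o2 c d = 0].
Proof.
have wE' a b : w a b c d = \sum_k \sum_l E c k * E d l *
    (E *m (\matrix_(i, j) weyl_of i j k l) *m E^T) a b.
  rewrite /w /contract4 exchange_big22; apply: eq_bigr => k _; apply: eq_bigr => l _.
  rewrite congr_mxE mulr_sumr; apply: eq_bigr => i _.
  rewrite mulr_sumr; apply: eq_bigr => j _; rewrite mxE; ring.
have anti k l i j : (\matrix_(a, b) weyl_of a b k l) j i = - (\matrix_(a, b) weyl_of a b k l) i j.
  by rewrite !mxE /weyl_of Rm_anti12; ring.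
split; rewrite !wE' -?sumrB -?big_split big1 // => k _;
  rewrite -?sumrB -?big_split big1 // => l _; have [] := self_dual_part_eq0 EGE EJ (anti k l) (asd k l);
  rewrite /sd1 /sd2 /sd3 => H1 H2 H3.
- by rewrite /= -mulrDr H1 mulr0.
- by rewrite /= -mulrBr H2 mulr0.
- by rewrite /= -mulrDr H3 mulr0.
Qed.

Local Notation kappa := (- (scalar_of / 12)).

(** The Weyl tensor has no self-dual part, and a J-invariant trace-free Ricci
    tensor sends self-dual forms other than [J1] to zero; only the scalar part
    remains. *)
Lemma asd_curvature23 a b :
  r a b o0 o2 - r a b o1 o3 = kappa * J2 a b /\
  r a b o0 o3 + r a b o1 o2 = kappa * J3 a b.
Proof.
have [rho11 rho33 rho01 rho23 [rho13 rho12]] := J1_invariant_sym rho_sym rho_J.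
have rho10 := rho_sym o0 o1; have rho32 := rho_sym o2 o3.
have rho20 := rho_sym o0 o2; have rho30 := rho_sym o0 o3.
have rho21 := rho_sym o1 o2; have rho31 := rho_sym o1 o3.
have := scalarE; rewrite sum4 => sE.
have [_ w2 w3] := w_sd a b.
move: w2 w3; rewrite !wE !(r_pair _ _ a b).
rewrite [J2 a b]mxE [J3 a b]mxE.
by move: b; apply: ord4_ind; move: a; apply: ord4_ind; rewrite /= => w2 w3; split; lra.
Qed.

(** Here the trace-free Ricci tensor contributes an anti-self-dual form, so that
    only the self-dual part is determined. *)
Lemma asd_curvature1 :
  [/\ (r o0 o1 o0 o1 + r o0 o1 o2 o3) + (r o2 o3 o0 o1 + r o2 o3 o2 o3) = 2 * kappa,
      (r o0 o2 o0 o1 + r o0 o2 o2 o3) - (r o1 o3 o0 o1 + r o1 o3 o2 o3) = 0 &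
      (r o0 o3 o0 o1 + r o0 o3 o2 o3) + (r o1 o2 o0 o1 + r o1 o2 o2 o3) = 0].
Proof.
have [rho11 rho33 rho01 rho23 [rho13 rho12]] := J1_invariant_sym rho_sym rho_J.
have rho10 := rho_sym o0 o1; have rho32 := rho_sym o2 o3.
have rho20 := rho_sym o0 o2; have rho30 := rho_sym o0 o3.
have rho21 := rho_sym o1 o2; have rho31 := rho_sym o1 o3.
have := scalarE; rewrite sum4 => sE.
have W c d := (w_sd c d).
have r0123 := r_pair o0 o1 o2 o3.
split; rewrite ?(r_pair o0 o2) ?(r_pair o1 o3) ?(r_pair o0 o3) ?(r_pair o1 o2).
- have [w1 _ _] := w_sd o0 o1; have [v1 _ _] := w_sd o2 o3.
  by move: w1 v1; rewrite !wE /=; lra.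
- have [w1 _ _] := w_sd o0 o2; have [v1 _ _] := w_sd o1 o3.
  by move: w1 v1; rewrite !wE /=; lra.
- have [w1 _ _] := w_sd o0 o3; have [v1 _ _] := w_sd o1 o2.
  by move: w1 v1; rewrite !wE /=; lra.
Qed.

End AntiSelfDualCurvature.

(** * The local obstruction in an adapted frame *)

(** Reduces an equation to a known combination of equations; the second premise is
    a ring identity. *)
Lemma eq_lincomb (K : zmodType) (a b c d : K) : a = b -> c - d = a - b -> c = d.
Proof. by move=> -> /eqP; rewrite subrr subr_eq0 => /eqP. Qed.

Section AdaptedFrame.
Variables (R : realFieldType) (A : comPzRingType) (X : Type).
Variable ev : X -> {rmorphism A -> R}.
Hypothesis ev_inj : forall a b : A, (forall x, ev x a = ev x b) -> a = b.
Variable e : 'I_4 -> A -> A.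
Hypothesis eB : forall i a b, e i (a - b) = e i a - e i b.
Hypothesis eM : forall i a b, e i (a * b) = e i a * b + a * e i b.
Variable con : 'I_4 -> 'I_4 -> 'I_4 -> A.
Local Notation brk a b d := (con a b d - con b a d).
Hypothesis e_comm : forall a b f,
  e a (e b f) - e b (e a f) = \sum_d brk a b d * e d f.
Variable fc : 'I_4 -> 'I_4 -> 'I_4 -> 'I_4 -> A.
Hypothesis fcE : forall a b c d, fc a b c d =
  e a (con b c d) - e b (con a c d) - \sum_g brk a b g * con g c d
  + \sum_m (con b c m * con a m d - con a c m * con b m d).
Hypothesis fc_bianchi1 : forall a b c d, fc a b c d + fc b c a d + fc c a b d = 0.
Hypothesis fc_bianchi2 : forall a b c p q,
  let db a b c := e c (fc a b p q) - \sum_d brk c a d * fc d b p q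
    + \sum_m (fc a b p m * con c m q - con c p m * fc a b m q) in
  db a b c + db b c a + db c a b = 0.
Hypothesis con_skew : forall a c d, con a d c = - con a c d.
Hypothesis fc_anti : forall a b c d, fc b a c d = - fc a b c d.
Hypothesis fc_skew : forall a b c d, fc a b d c = - fc a b c d.

Variables S1 S2 S3 : 'I_4 -> A.
Hypothesis S1_con : forall a, S1 a = con a o0 o1 + con a o2 o3.
Hypothesis S2_con : forall a, S2 a = con a o0 o2 - con a o1 o3.
Hypothesis S3_con : forall a, S3 a = con a o0 o3 + con a o1 o2.

Let e0 i : e i 0 = 0. Proof. by have := eB i 0 0; rewrite !subrr. Qed.
Let eN i a : e i (- a) = - e i a. Proof. by rewrite -sub0r eB e0 sub0r. Qed.
Let eD i a b : e i (a + b) = e i a + e i b.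
Proof. by rewrite -{1}[b]opprK eB eN opprK. Qed.
Let eMn i a n : e i (a *+ n) = e i a *+ n.
Proof. by elim: n => [|n IH]; rewrite ?mulr0n ?e0 // !mulrS eD IH. Qed.

Let div_nat n (a : A) : a *+ n.+1 = 0 -> a = 0.
Proof.
move=> an; apply: ev_inj => x; rewrite rmorph0; apply/eqP.
by have := congr1 (ev x) an; rewrite rmorphMn rmorph0 => /eqP; rewrite mulrn_eq0.
Qed.

Let skew_diag (T : 'I_4 -> 'I_4 -> A) : (forall c d, T d c = - T c d) ->
  forall c, T c c = 0.
Proof.
move=> skew c; apply: (@div_nat 1); rewrite mulr2n {1}skew; exact: addNr.
Qed.

Let con_diag a c : con a c c = 0. Proof. exact: (skew_diag (con_skew a)). Qed.
Let fc_diag a b c : fc a b c c = 0. Proof. exact: (skew_diag (fc_skew a b)). Qed.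

Let skews a := (con_diag a, con_skew a o0 o1, con_skew a o0 o2, con_skew a o0 o3,
  con_skew a o1 o2, con_skew a o1 o3, con_skew a o2 o3).
Let fc_skews a b := (fc_diag a b, fc_skew a b o0 o1, fc_skew a b o0 o2,
  fc_skew a b o0 o3, fc_skew a b o1 o2, fc_skew a b o1 o3, fc_skew a b o2 o3).

(** Self-dual and anti-self-dual matrices commute, so that the self-dual components
    of the connection form a closed system; the anti-self-dual ones enter only
    through the brackets. *)
Let fc_sd1 a b : fc a b o0 o1 + fc a b o2 o3 =
  e a (S1 b) - e b (S1 a) - \sum_g brk a b g * S1 g + (S2 a * S3 b - S2 b * S3 a).
Proof.
rewrite !fcE !sum4 !S1_con !S2_con !S3_con !(eD, eN) !(skews a) !(skews b); ring.
Qed.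

Let fc_sd2 a b : fc a b o0 o2 - fc a b o1 o3 =
  e a (S2 b) - e b (S2 a) - \sum_g brk a b g * S2 g + (S3 a * S1 b - S3 b * S1 a).
Proof.
rewrite !fcE !sum4 !S1_con !S2_con !S3_con !(eD, eN) !(skews a) !(skews b) /=; ring.
Qed.

Let fc_sd3 a b : fc a b o0 o3 + fc a b o1 o2 =
  e a (S3 b) - e b (S3 a) - \sum_g brk a b g * S3 g + (S1 a * S2 b - S1 b * S2 a).
Proof.
rewrite !fcE !sum4 !S1_con !S2_con !S3_con !(eD, eN) !(skews a) !(skews b); ring.
Qed.

Variable k : A.
Hypothesis fc_k2 : forall a b, fc a b o0 o2 - fc a b o1 o3 = k * J2 a b.
Hypothesis fc_k3 : forall a b, fc a b o0 o3 + fc a b o1 o2 = k * J3 a b.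
Let f a b := fc a b o0 o1 + fc a b o2 o3.
Hypothesis f_diag : f o0 o1 + f o2 o3 = 2 * k.
Hypothesis f_02 : f o0 o2 - f o1 o3 = 0.
Hypothesis f_03 : f o0 o3 + f o1 o2 = 0.

Let db2 a b c := e c (k * J2 a b) - \sum_d brk c a d * (k * J2 d b)
     + (S3 c * f a b - k * J3 a b * S1 c).
Let db3 a b c := e c (k * J3 a b) - \sum_d brk c a d * (k * J3 d b)
     + (k * J2 a b * S1 c - S2 c * f a b).

(** As for [fc_sd1], only self-dual components occur in the self-dual components of
    the second Bianchi identity. *)
Let bianchi_sd2 a b c : db2 a b c + db2 b c a + db2 c a b = 0.
Proof.
rewrite /db2.
have sd u v w : e w (k * J2 u v) - \sum_d brk w u d * (k * J2 d v)
     + (S3 w * f u v - k * J3 u v * S1 w) =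
   (e w (fc u v o0 o2) - \sum_d brk w u d * fc d v o0 o2
    + \sum_m (fc u v o0 m * con w m o2 - con w o0 m * fc u v m o2)) -
   (e w (fc u v o1 o3) - \sum_d brk w u d * fc d v o1 o3
    + \sum_m (fc u v o1 m * con w m o3 - con w o1 m * fc u v m o3)).
  rewrite -!fc_k2 -fc_k3 eB /f S1_con S3_con !sum4 -!fc_k2 !(fc_skews u v) !(skews w).
  by ring.
rewrite /= !sd; have := fc_bianchi2 a b c o0 o2; have := fc_bianchi2 a b c o1 o3.
move=> /= H1 H2; apply: (eq_lincomb (etrans H2 (esym H1))).
ring.
Qed.

Let bianchi_sd3 a b c : db3 a b c + db3 b c a + db3 c a b = 0.
Proof.
rewrite /db3.
have sd u v w : e w (k * J3 u v) - \sum_d brk w u d * (k * J3 d v)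
     + (k * J2 u v * S1 w - S2 w * f u v) =
   (e w (fc u v o0 o3) - \sum_d brk w u d * fc d v o0 o3
    + \sum_m (fc u v o0 m * con w m o3 - con w o0 m * fc u v m o3)) +
   (e w (fc u v o1 o2) - \sum_d brk w u d * fc d v o1 o2
    + \sum_m (fc u v o1 m * con w m o2 - con w o1 m * fc u v m o2)).
  rewrite -!fc_k3 -fc_k2 eD /f S1_con S2_con !sum4 -!fc_k3 !(fc_skews u v) !(skews w).
  by ring.
rewrite /= !sd; have := fc_bianchi2 a b c o0 o3; have := fc_bianchi2 a b c o1 o2.
move=> /= H1 H2; apply: (eq_lincomb (congr2 +%R H1 H2)).
ring.
Qed.

Variable r : A.
Hypothesis r_neq0 : forall x, ev x r != 0.
Hypothesis S2E : forall a, S2 a = r *+ (a == o1).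
Hypothesis S3E : forall a, S3 a = r *+ (a == o0).

Let r_cancel (a : A) : r * a = 0 -> a = 0.
Proof.
move=> ra; apply: ev_inj => s; rewrite rmorph0; apply/eqP.
have := congr1 (ev s) ra; rewrite rmorphM rmorph0 => /eqP.
by rewrite mulf_eq0 (negPf (r_neq0 s)).
Qed.

Let conE a : (con a o1 o2 = r *+ (a == o0) - con a o0 o3) *
  (con a o1 o3 = con a o0 o2 - r *+ (a == o1)) *
  (con a o2 o3 = S1 a - con a o0 o1).
Proof.
rewrite -S2E -S3E S1_con S2_con S3_con; do 2?split; ring.
Qed.

Local Ltac expand H := rewrite ?/db2 ?/db3 ?(fc_sd1, fc_sd2, fc_sd3) ?(S2E, S3E) ?sum4 ?(S2E, S3E)
  ?skews ?conE ?[J2 _ _]mxE ?[J3 _ _]mxE /=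
  ?(mulr0n, mulr1n, mulr0, mulr1, mulrN1, eN, e0) in H.

(** The eight components of [fc_k2] and [fc_k3] in which k does not occur. *)
Let structure_eqs :
  [/\ e o0 r = - (S1 o1 + con o1 o0 o1) * r, e o1 r = (S1 o0 + con o0 o0 o1) * r,
       e o2 r = r * con o0 o0 o2, e o2 r = - r * con o1 o0 o3 &
   [/\ r * (S1 o3 + con o3 o0 o1) = r * con o1 o0 o3,
        r * (S1 o3 + con o3 o0 o1) = - r * con o0 o0 o2,
        r * (con o2 o0 o2 + con o3 o0 o3) = 0 &
        r * (con o3 o0 o2 - con o2 o0 o3) = 0]].
Proof.
have H01 := fc_k2 o0 o1; expand H01.
have G01 := fc_k3 o0 o1; expand G01.
have G02 := fc_k3 o0 o2; expand G02.
have H03 := fc_k2 o0 o3; expand H03.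
have H12 := fc_k2 o1 o2; expand H12.
have G13 := fc_k3 o1 o3; expand G13.
have H23 := fc_k2 o2 o3; expand H23.
have G23 := fc_k3 o2 o3; expand G23.
do 2?split.
- by apply: (eq_lincomb H01); ring.
- by apply: (eq_lincomb (esym G01)); ring.
- by apply: (eq_lincomb (esym G02)); ring.
- by apply: (eq_lincomb (esym H12)); ring.
- by apply: (eq_lincomb (esym G13)); ring.
- by apply: (eq_lincomb H03); ring.
- by apply: (eq_lincomb H23); ring.
- by apply: (eq_lincomb (esym G23)); ring.
Qed.

(** The four components of [fc_k2] and [fc_k3] in which k occurs; a signed sum of
    them eliminates the connection coefficients and leaves the first equation. *)
Let curvature_scale_eqs :
  [/\ 2 * k = r * r, e o3 r = r * con o0 o0 o3 - k, r * con o1 o0 o2 = r * con o0 o0 o3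
    & r * (S1 o2 + con o2 o0 o1) = r * con o0 o0 o3 - k].
Proof.
have H02 := fc_k2 o0 o2; expand H02.
have G03 := fc_k3 o0 o3; expand G03.
have G12 := fc_k3 o1 o2; expand G12.
have H13 := fc_k2 o1 o3; expand H13.
have kr : 2 * k = r * r.
  apply/eqP; rewrite -subr_eq0; apply/eqP; apply: (@div_nat 1).
  apply: (eq_lincomb (esym (congr2 (fun a b => a - b)
    (congr2 +%R (congr2 +%R H02 G12) G03) H13))); rewrite mulr2n; ring.
split=> //.
- by apply: (eq_lincomb (esym G03)); ring.
- by apply: (eq_lincomb (congr2 +%R (congr2 +%R H02 G12) kr)); ring.
- by apply: (eq_lincomb (congr2 +%R H02 kr)); ring.
Qed.

(** Eight components of the second Bianchi identity, linear in dk and in [f]; with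
    the known self-dual part of [f] they determine both. *)
Let scale_const_eqs :
  [/\ forall a, e a k = 0, f o0 o1 = k /\ f o2 o3 = k,
       f o0 o2 = 0 /\ f o1 o3 = 0 & f o0 o3 = 0 /\ f o1 o2 = 0].
Proof.
have H012 := bianchi_sd2 o0 o1 o2; expand H012.
have G012 := bianchi_sd3 o0 o1 o2; expand G012.
have H013 := bianchi_sd2 o0 o1 o3; expand H013.
have G013 := bianchi_sd3 o0 o1 o3; expand G013.
have H023 := bianchi_sd2 o0 o2 o3; expand H023.
have G023 := bianchi_sd3 o0 o2 o3; expand G023.
have H123 := bianchi_sd2 o1 o2 o3; expand H123.
have G123 := bianchi_sd3 o1 o2 o3; expand G123.
have f_anti a b : f b a = - f a b by rewrite /f !(fc_anti a b) opprD.
rewrite !(f_anti o0 o2) in H012 G012; rewrite !(f_anti o0 o3) in H013 G013 H023 G023.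
rewrite !(f_anti o1 o3) in H123 G123.
have k2 : e o2 k = 0 by apply: (eq_lincomb (esym G023)); ring.
have k0 : e o0 k = 0.
  apply: (@div_nat 1); apply: (eq_lincomb (congr2 (fun a b => a - b) G012
    (congr2 +%R H013 (congr1 ( *%R r) f_02)))); ring.
have k1 : e o1 k = 0.
  apply: (@div_nat 1); apply: (eq_lincomb (congr2 (fun a b => a - b)
    (congr1 ( *%R r) f_03) (congr2 +%R H012 G013))); ring.
have k3 : e o3 k = 0.
  by apply: (@div_nat 1); apply: (eq_lincomb (congr2 +%R H023 G123)); ring.
have f02 : f o0 o2 = 0.
  apply: (@div_nat 1); apply: r_cancel; apply: (eq_lincomb (congr2 +%R G012
    (congr2 +%R H013 (congr1 ( *%R r) f_02)))); ring.
have f13 : f o1 o3 = 0 by apply: (eq_lincomb (congr2 (fun a b => a - b) f02 f_02)); ring.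
have f12 : f o1 o2 = 0.
  by apply: r_cancel; apply: (eq_lincomb (congr2 +%R H012 k1)); ring.
have f03 : f o0 o3 = 0.
  by apply: r_cancel; apply: (eq_lincomb (congr2 +%R G013 k1)); ring.
have f23 : f o2 o3 = k.
  apply/eqP; rewrite -subr_eq0; apply/eqP; apply: r_cancel.
  by apply: (eq_lincomb (congr2 (fun a b => a - b) H023 k3)); ring.
have f01 : f o0 o1 = k by apply: (eq_lincomb (congr2 (fun a b => a - b) f_diag f23)); ring.
by split=> //; apply: ord4_ind.
Qed.

Let r_const a : e a r = 0.
Proof.
have [kr _ _ _] := curvature_scale_eqs; have [k0 _ _ _] := scale_const_eqs.
apply: (@div_nat 1); apply: r_cancel.
have := congr1 (e a) kr; rewrite !eM k0 -[2]/(1 *+ 2) eMn.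
have -> : e a 1 = 0.
  by apply: (@addrI _ (e a 1)); rewrite addr0 -{3}[1]mulr1 eM mul1r mulr1.
rewrite mul0rn mul0r mulr0 addr0 => kr'.
by apply: (eq_lincomb (esym kr')); rewrite mulr2n; ring.
Qed.

Let h := con o1 o0 o2.
Let p := con o2 o0 o2.
Let q := con o2 o0 o3.

(** Once r is constant, the structure equations are linear in the connection
    coefficients. *)
Let normal_form :
  [/\ r = h + h, k = h * (h + h), con o0 o0 o2 = 0, con o0 o0 o3 = h &
  [/\ con o1 o0 o3 = 0, con o3 o0 o2 = q, con o3 o0 o3 = - p &
      forall a, con a o0 o1 = - S1 a]].
Proof.
have [x1 x0 y0 z1 [x3 _ yz32 yz23]] := structure_eqs.
have [kr r3 y1 x2] := curvature_scale_eqs.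
move: x1 x0 y0 z1 r3; rewrite !r_const => x1 x0 y0 z1 r3.
have y0' : con o0 o0 o2 = 0 by apply: r_cancel.
have z1' : con o1 o0 o3 = 0.
  by apply: r_cancel; apply: (eq_lincomb z1); ring.
have hE : h = con o0 o0 o3.
  apply/eqP; rewrite -subr_eq0; apply/eqP; apply: r_cancel.
  by apply: (eq_lincomb y1); rewrite /h; ring.
have rE : r = h + h.
  apply/eqP; rewrite -subr_eq0; apply/eqP; apply: r_cancel; rewrite hE.
  by apply: (eq_lincomb (congr2 (fun a b => a - b) r3 (congr2 +%R kr (esym r3)))); ring.
split=> //.
- by apply: (eq_lincomb r3); rewrite -hE rE; ring.
- split=> //.
  + apply/eqP; rewrite -subr_eq0; apply/eqP; apply: r_cancel; exact: yz23.
  + by apply/eqP; rewrite -subr_eq0 opprK addrC; apply/eqP; apply: r_cancel; exact: yz32.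
  + move=> a; apply/eqP; rewrite -subr_eq0 opprK addrC; apply/eqP; apply: r_cancel.
    move: a; apply: ord4_ind.
    * by apply: (eq_lincomb (esym x0)); ring.
    * by apply: (eq_lincomb x1); ring.
    * by rewrite x2 -r3.
    * by rewrite x3 z1' mulr0.
Qed.

Let h_const a : e a h = 0.
Proof.
have [rE _ _ _ _] := normal_form.
by apply: (@div_nat 1); rewrite mulr2n -eD -rE r_const.
Qed.

Let normE := let: And5 rE kE c002 c003 (And4 c103 c302 c303 c01) := normal_form in
  (rE, kE, (c002, c003, c103, c302, c303), c01).

Local Ltac normalize H := rewrite ?fc_sd1 ?(S2E, S3E) ?fcE ?sum4 ?(S2E, S3E) ?skews ?conE
   ?normE /= ?(mulr0n, mulr1n) ?(eN, eB, eD) ?h_const -?/h -?/p -?/q ?(eN, eB, eD, h_const, e0) in H.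

(** The curvature along w1 on (e0, e1) is known; two components of the first
    Bianchi identity eliminate the derivatives of the connection coefficients from
    it. *)
Let norm_pq : p * p + q * q = h * h *+ 6.
Proof.
have [_ [f01 _] _ _] := scale_const_eqs; rewrite /f in f01; normalize f01.
have B3 := fc_bianchi1 o0 o1 o2 o3; normalize B3.
have B2 := fc_bianchi1 o0 o1 o3 o2; normalize B2.
apply/eqP; rewrite -subr_eq0; apply/eqP; apply: (@div_nat 3).
apply: (eq_lincomb (congr2 +%R (congr2 (fun a b => a - b) B2 B3) (congr1 (fun a => a *+ 4) f01))).
ring.
Qed.

(** Two combinations of the first Bianchi identity with the vanishing of the
    curvature along w1 on (e0, e2) and (e0, e3). *)
Let bianchi_pq :
  e o2 q - e o3 p + (S1 o2 * p + S1 o3 * q) *+ 5 = 0 /\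
  e o2 p + e o3 q - (S1 o2 * q - S1 o3 * p) *+ 5 = 0.
Proof.
have [_ _ [f02 _] [f03 _]] := scale_const_eqs; rewrite /f in f02 f03.
normalize f02; normalize f03.
have B2 := fc_bianchi1 o0 o2 o3 o2; normalize B2.
have B3 := fc_bianchi1 o0 o2 o3 o3; normalize B3.
split.
  by apply: (eq_lincomb (congr2 +%R B2 (congr1 (fun a => a *+ 2) f02))); ring.
by apply: (eq_lincomb (esym (congr2 +%R B3 (congr1 (fun a => a *+ 2) f03)))); ring.
Qed.

Let h_neq0 s : ev s h != 0.
Proof.
have [rE _ _ _ _] := normal_form; apply: contraNneq (r_neq0 s) => h0.
by rewrite rE rmorphD h0 addr0.
Qed.

(** Since p^2 + q^2 is constant, the gradients of p and q satisfy two more linear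
    equations besides [bianchi_pq]; the resulting system is invertible because its
    determinant is, up to sign, p^2 + q^2 = 6 h^2, which is nonzero. *)
Let D_pq :
  [/\ e o2 p = S1 o2 * q *+ 5, e o3 p = S1 o3 * q *+ 5,
      e o2 q = - (S1 o2 * p *+ 5) & e o3 q = - (S1 o3 * p *+ 5)].
Proof.
have H a : p * e a p + q * e a q = 0.
  apply: (@div_nat 1); have := congr1 (e a) norm_pq.
  rewrite eD !eM eMn eM h_const mul0r mulr0 addr0 mul0rn => E.
  by apply: (eq_lincomb E); rewrite mulr2n; ring.
have H2 := H o2; have H3 := H o3; have [B1 B2] := bianchi_pq.
suff K s : [/\ ev s (e o2 p) = ev s (S1 o2 * q *+ 5), ev s (e o3 p) = ev s (S1 o3 * q *+ 5),
   ev s (e o2 q) = ev s (- (S1 o2 * p *+ 5)) & ev s (e o3 q) = ev s (- (S1 o3 * p *+ 5))].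
  by split; apply: ev_inj => s; have [] := K s.
have := congr1 (ev s) H2; have := congr1 (ev s) H3.
have := congr1 (ev s) B1; have := congr1 (ev s) B2.
have := congr1 (ev s) norm_pq; have := h_neq0 s.
rewrite !(rmorphD, rmorphN, rmorphMn, rmorphM, rmorph0).
move: (ev s (e o2 p)) (ev s (e o3 p)) (ev s (e o2 q)) (ev s (e o3 q)).
move: (ev s p) (ev s q) (ev s h) (ev s (S1 o2)) (ev s (S1 o3)).
move=> P Q H' a b p2 p3 q2 q3 H'0 N E2 E1 E3 E4.
have N0 : P * P + Q * Q != 0 by rewrite N mulrn_eq0 mulf_eq0 (negPf H'0).
have E := congr2 (fun a b => a - b) (congr2 +%R E3 (congr1 ( *%R P) E1)) (congr1 ( *%R Q) E2).
have u0 : p2 = a * Q *+ 5.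
  apply/eqP; rewrite -subr_eq0; apply/eqP; apply: (mulfI N0).
  apply: (eq_lincomb (congr2 (fun a b => a - b) (congr1 ( *%R P) E4) (congr1 ( *%R Q) E))).
  by ring.
have v0 : q2 = - (a * P *+ 5).
  apply/eqP; rewrite -subr_eq0; apply/eqP; apply: (mulfI N0).
  apply: (eq_lincomb (congr2 +%R (congr1 ( *%R Q) E4) (congr1 ( *%R P) E))).
  by ring.
split=> //.
- by apply: (eq_lincomb (congr2 (fun a b => b - a) E1 v0)); ring.
- by apply: (eq_lincomb (congr2 (fun a b => a - b) E2 u0)); ring.
Qed.

Let bracket23 g : e o2 (e o3 g) - e o3 (e o2 g) =
  - (S1 o2 *+ 2) * e o2 g - (S1 o3 *+ 2) * e o3 g.
Proof.
have H := e_comm o2 o3 g; normalize H.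
by apply: (eq_lincomb H); ring.
Qed.

(** Differentiating [D_pq] once more, the bracket of e2 and e3 leaves dS1(e2, e3)
    times q or p, and dS1(e2, e3) = k is not zero. *)
Lemma adapted_frame_absurd : X -> False.
Proof.
move=> s.
have [_ [_ f23] _ _] := scale_const_eqs; rewrite /f in f23; normalize f23.
have [p2 p3 q2 q3] := D_pq.
have hq : h * h * q *+ 10 = 0.
  have := bracket23 p; rewrite p2 p3 !eMn !eM q2 q3 => E.
  apply: (eq_lincomb (esym (congr2 (fun a b => a - b) (congr1 (fun a => a *+ 5 * q) f23) E))).
  ring.
have hp : h * h * p *+ 10 = 0.
  have := bracket23 q; rewrite q2 q3 !eN !eMn !eM p2 p3 => E.
  apply: (eq_lincomb (esym (congr2 +%R (congr1 (fun a => a *+ 5 * p) f23) E))).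
  ring.
have := h_neq0 s; have := congr1 (ev s) norm_pq.
have := congr1 (ev s) hq; have := congr1 (ev s) hp.
rewrite !(rmorphD, rmorphMn, rmorphM, rmorph0).
move: (ev s p) (ev s q) (ev s h) => P Q H' /eqP + /eqP + N H'0.
rewrite !mulrn_eq0 !mulf_eq0 (negPf H'0) /= => /eqP P0 /eqP Q0.
by move/esym/eqP: N; rewrite P0 Q0 !mulr0 addr0 mulrn_eq0 mulf_eq0 (negPf H'0).
Qed.

End AdaptedFrame.

(** * Hermitian frames *)

Lemma J1_rows (K : comPzRingType) (M : 'M[K]_4) :
  [/\ row o0 (J1 *m M) = row o1 M, row o1 (J1 *m M) = - row o0 M,
      row o2 (J1 *m M) = row o3 M & row o3 (J1 *m M) = - row o2 M].
Proof.
by split; apply/rowP => i; rewrite /J1 /mx4 !mxE sum4 !mxE /=; ring.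
Qed.

Section HermitianFrame.
Variables (K : comPzRingType).
Hypothesis half_inj : forall a : K, a *+ 2 = 0 -> a = 0.
Variables (g j : 'M[K]_4).
Hypothesis g_sym : g^T = g.
Hypothesis j_sqr : j *m j = - 1%:M.
Hypothesis j_orth : j *m g *m j^T = g.

Definition rows4 (u0 u1 u2 u3 : 'rV[K]_4) : 'M[K]_4 :=
  \matrix_(i < 4) nth 0 [:: u0; u1; u2; u3] i.

Definition pairing (u v : 'rV[K]_4) : K := (u *m g *m v^T) 0 0.

Lemma fundamental_skew : (j *m g)^T = - (j *m g).
Proof.
by rewrite trmx_mul g_sym -[in RHS]j_orth !mulmxA j_sqr !mulNmx mul1mx opprK.
Qed.

Lemma skew_pairing (M : 'M[K]_4) (u : 'rV[K]_4) : M^T = - M ->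
  (u *m M *m u^T) 0 0 = 0.
Proof.
move=> skew; apply: half_inj.
have : (u *m M *m u^T)^T = - (u *m M *m u^T).
  by rewrite !trmx_mul trmxK skew mulNmx mulmxN mulmxA.
by move=> /matrixP/(_ 0 0); rewrite mxE [RHS]mxE mulr2n => {1}->; rewrite addNr.
Qed.

Lemma pairing_sym u v : pairing u v = pairing v u.
Proof.
rewrite /pairing; have -> : v *m g *m u^T = (u *m g *m v^T)^T by rewrite !trmx_mul trmxK g_sym mulmxA.
by rewrite [RHS]mxE.
Qed.

Lemma pairing_jj u v : pairing (u *m j) (v *m j) = pairing u v.
Proof. by rewrite /pairing trmx_mul !mulmxA -(mulmxA u) -(mulmxA u) j_orth. Qed.

Lemma pairing_ju u : pairing (u *m j) u = 0.
Proof. by rewrite /pairing -(mulmxA u); apply: skew_pairing fundamental_skew. Qed.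

Lemma hermitian_frame_j u v : rows4 u (u *m j) v (v *m j) *m j =
  J1 *m rows4 u (u *m j) v (v *m j).
Proof.
have jj w : w *m j *m j = - w by rewrite -mulmxA j_sqr mulmxN mulmx1.
have [r0 r1 r2 r3] := J1_rows (rows4 u (u *m j) v (v *m j)).
by apply/row_matrixP; apply: ord4_ind; rewrite row_mul ?r0 ?r1 ?r2 ?r3 !rowK /= ?jj.
Qed.

Lemma hermitian_frame_orthonormal u v : pairing u u = 1 -> pairing v v = 1 ->
  pairing u v = 0 -> pairing (u *m j) v = 0 ->
  let E := rows4 u (u *m j) v (v *m j) in E *m g *m E^T = 1%:M.
Proof.
move=> uu vv uv juv E.
have jj w : w *m j *m j = - w by rewrite -mulmxA j_sqr mulmxN mulmx1.
have ujv : pairing u (v *m j) = 0.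
  rewrite -pairing_jj jj /pairing linearN /= mulmxN mxE.
  by rewrite -/(pairing (u *m j) v) juv oppr0.
have EE a b : (E *m g *m E^T) a b = pairing (row a E) (row b E).
  by rewrite /pairing -row_mul [LHS]mxE [RHS]mxE; apply: eq_bigr => k _; rewrite !mxE.
apply/matrixP => a b; rewrite EE !rowK [RHS]mxE.
have juu := pairing_ju u; have jvv := pairing_ju v.
have jujv : pairing (u *m j) (v *m j) = 0 by rewrite pairing_jj.
have juju : pairing (u *m j) (u *m j) = 1 by rewrite pairing_jj.
have jvjv : pairing (v *m j) (v *m j) = 1 by rewrite pairing_jj.
by move: b; apply: ord4_ind; move: a; apply: ord4_ind => //=; rewrite pairing_sym.
Qed.

End HermitianFrame.

Section PointwiseHermitianFrame.
Variables (R : realType) (G J : 'M[R]_4).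
Hypothesis G_sym : G^T = G.
Hypothesis G_pos : forall v : 'rV[R]_4, v != 0 -> 0 < (v *m G *m v^T) 0 0.
Hypothesis J_sqr : J *m J = - 1%:M.
Hypothesis J_orth : J *m G *m J^T = G.

Lemma mulr2n_eq0 (a : R) : a *+ 2 = 0 -> a = 0.
Proof. by move=> /eqP; rewrite mulrn_eq0 => /eqP. Qed.

Lemma exists_unit (v : 'rV[R]_4) : v != 0 ->
  exists2 a : R, a != 0 & pairing G (a *: v) (a *: v) = 1.
Proof.
move=> /G_pos v0; pose a := (Num.sqrt (pairing G v v))^-1.
have s0 : Num.sqrt (pairing G v v) != 0 by rewrite sqrtr_eq0 -ltNge.
exists a; first by rewrite invr_eq0.
have -> : pairing G (a *: v) (a *: v) = a ^+ 2 * pairing G v v.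
  by rewrite /pairing linearZ /= -!scalemxAl -scalemxAr scalerA mxE expr2.
by rewrite /a exprVn sqr_sqrtr ?ltW// mulVf// gt_eqF.
Qed.

(** Counting dimensions, some nonzero vector is orthogonal to u and J u. *)
Lemma exists_hermitian_frame (u : 'rV[R]_4) : pairing G u u = 1 ->
  exists E : 'M[R]_4,
    [/\ E *m G *m E^T = 1%:M, E *m J = J1 *m E & row o0 E = u].
Proof.
move=> uu.
pose M : 'M[R]_(4, 1 + 1) := row_mx (G *m u^T) (G *m (u *m J)^T).
have : kermx M != 0.
  rewrite -mxrank_eq0 mxrank_ker subn_eq0 -ltnNge.
  by apply: leq_ltn_trans (rank_leq_col M) _.
case/rowV0Pn => w /sub_kermxP wM w0.
have [wu wju] : pairing G u w = 0 /\ pairing G (u *m J) w = 0.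
  move: wM; rewrite mul_mx_row => /eqP; rewrite row_mx_eq0 !mulmxA => /andP[/eqP H1 /eqP H2].
  by split; rewrite pairing_sym // /pairing ?H1 ?H2 mxE.
have [a a0 ww] := exists_unit w0.
exists (rows4 u (u *m J) (a *: w) ((a *: w) *m J)); split.
- apply: hermitian_frame_orthonormal => //; first exact: mulr2n_eq0.
    by rewrite /pairing linearZ /= -scalemxAr mxE -/(pairing _ _ _) wu mulr0.
  by rewrite /pairing linearZ /= -scalemxAr mxE -/(pairing _ _ _) wju mulr0.
- exact: hermitian_frame_j.
- by rewrite rowK.
Qed.

End PointwiseHermitianFrame.

(** * Almost Kaehler geometry over a differential ring *)

Section AlmostKaehlerRing.
Variables (R : realType) (A : comPzRingType) (X : Type).
Variable ev : X -> {rmorphism A -> R}.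
Hypothesis ev_inj : forall a b : A, (forall x, ev x a = ev x b) -> a = b.
Hypothesis exists_rsqrt : forall a : A, (forall x, 0 < ev x a) ->
  exists2 h : A, h * h * a = 1 & forall x, 0 < ev x h.
Variable D : 'I_4 -> {additive A -> A}.
Hypothesis DM : forall i a b, D i (a * b) = D i a * b + a * D i b.
Hypothesis D_comm : forall i j a, D i (D j a) = D j (D i a).
Variables (g gi j : 'M[A]_4) (half : A).
Hypothesis half2 : half *+ 2 = 1.
Hypothesis g_sym : g^T = g.
Hypothesis g_gi : g *m gi = 1%:M.
Hypothesis j_sqr : j *m j = - 1%:M.
Hypothesis j_orth : j *m g *m j^T = g.
Hypothesis g_pos : forall x (v : 'rV[R]_4), v != 0 ->
  0 < (v *m map_mx (ev x) g *m v^T) 0 0.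
Hypothesis closed : forall a b c,
  D a ((j *m g) b c) + D b ((j *m g) c a) + D c ((j *m g) a b) = 0.

Local Notation "''D[' i ] M" := (map_mx (D i) M) (at level 9, i at level 50, M at level 9).

Lemma mulr2n_inj (a : A) : a *+ 2 = 0 -> a = 0.
Proof. by move=> a2; rewrite -[a]mulr1 -half2 mulrnAr -mulrnAl a2 mul0r. Qed.

(** Twice the Christoffel symbols of the first kind. *)
Definition christ1 k : 'M[A]_4 :=
  \matrix_(a, m) (D k (g a m) + D a (g k m) - D m (g k a)).
Definition Gam k : 'M[A]_4 := half *: (christ1 k *m gi^T).

Lemma gi_sym : gi^T = gi.
Proof.
have := congr1 trmx g_gi; rewrite trmx_mul g_sym trmx1 => H.
by rewrite -[LHS]mulmx1 -g_gi mulmxA H mul1mx.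
Qed.

Lemma gE a b : g a b = g b a.
Proof. by rewrite -{1}g_sym mxE. Qed.

Lemma Gam_torsion_free a b c : Gam a b c = Gam b a c.
Proof.
rewrite !mxE; congr (_ * _); apply: eq_bigr => m _; congr (_ * _).
by rewrite !mxE (gE b a); ring.
Qed.

Lemma Gam_g k : Gam k *m g = half *: christ1 k.
Proof.
by rewrite -scalemxAl -mulmxA gi_sym (mulmx1C g_gi) mulmx1.
Qed.

Lemma metric_compatible k : 'D[k] g = Gam k *m g + g *m (Gam k)^T.
Proof.
have -> : g *m (Gam k)^T = (Gam k *m g)^T by rewrite trmx_mul g_sym.
rewrite Gam_g; apply/matrixP => a b; rewrite !mxE (gE k a) (gE k b) (gE b a).
rewrite -[LHS]mulr1 -half2 mulr2n; ring.
Qed.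

Definition riem (a b c d : 'I_4) : A := (curv D Gam a b *m g) c d.

Lemma riem_anti12 a b c d : riem b a c d = - riem a b c d.
Proof. by rewrite /riem curv_anti mulNmx mxNE. Qed.

Lemma riem_anti34 a b c d : riem a b d c = - riem a b c d.
Proof.
have := curv_skew DM D_comm a b metric_compatible.
have -> M : g *m M^T = (M *m g)^T by rewrite trmx_mul g_sym.
move=> /matrixP/(_ d c).
by rewrite mxDE [_^T _ _]mxE [RHS]mxE => /eqP; rewrite addr_eq0 => /eqP.
Qed.

Lemma riem_bianchi a b c d : riem a b c d + riem b c a d + riem c a b d = 0.
Proof.
rewrite /riem !mxE -!big_split big1 // => m _ /=.
by rewrite -!mulrDl algebraic_bianchi ?mul0r //; exact: Gam_torsion_free.
Qed.

Definition nablaJ k : 'M[A]_4 := 'D[k] j + j *m Gam k - Gam k *m j.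

Lemma D_1mx k m : 'D[k] (1%:M : 'M[A]_m) = 0.
Proof.
have D1 : D k 1 = 0.
  by apply: (@addrI _ (D k 1)); rewrite addr0 -{3}[1]mulr1 DM mul1r mulr1.
by apply/matrixP => a b; rewrite !mxE; case: (a == b); rewrite ?raddf0.
Qed.

Lemma nablaJ_anticomm k : nablaJ k *m j = - (j *m nablaJ k).
Proof.
have := congr1 (fun M : 'M[A]_4 => 'D[k] M) j_sqr.
rewrite (D_mulmx DM) (D_mxN D) D_1mx oppr0 => H.
rewrite /nablaJ !(mulmxDl, mulmxDr, mulNmx, mulmxN) !mulmxA j_sqr.
rewrite -!mulmxA j_sqr !(mulmxN, mulNmx, mulmx1, mul1mx) !mulmxA.
apply/eqP; rewrite -subr_eq0 -H; apply/eqP; apply/matrixP => a b.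
rewrite !(mxDE, mxNE); ring.
Qed.

Let jg_skew : (j *m g)^T = - (j *m g).
Proof. exact: fundamental_skew. Qed.

Lemma nabla_fundamental k :
  nablaJ k *m g = 'D[k] (j *m g) - Gam k *m (j *m g) - (j *m g) *m (Gam k)^T.
Proof.
rewrite (D_mulmx DM) metric_compatible /nablaJ.
rewrite !(mulmxDl, mulmxDr, mulNmx, mulmxN) !mulmxA.
by apply/matrixP => a b; rewrite !(mxDE, mxNE); ring.
Qed.

Lemma nablaJg_skew k : (nablaJ k *m g)^T = - (nablaJ k *m g).
Proof.
rewrite nabla_fundamental !(mx_trD, mx_trN) -(D_trmx D) [(Gam k *m _)^T]trmx_mul.
rewrite [(_ *m (Gam k)^T)^T]trmx_mul trmxK jg_skew (D_mxN D) !(mulmxN, mulNmx).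
by apply/matrixP => a b; rewrite !(mxDE, mxNE); ring.
Qed.

(** As the connection is torsion-free, the exterior derivative of the fundamental
    form is the cyclic sum of its covariant derivative. *)
Lemma nablaJ_closed a b c :
  (nablaJ a *m g) b c + (nablaJ b *m g) c a + (nablaJ c *m g) a b = 0.
Proof.
pose om := j *m g.
have omE p q : om q p = - om p q.
  by have /matrixP/(_ p q) := jg_skew; rewrite mxE mxNE.
have E k p q : (nablaJ k *m g) p q =
    D k (om p q) - \sum_m Gam k p m * om m q + \sum_m Gam k q m * om m p.
  have E1 : (Gam k *m om) p q = \sum_m Gam k p m * om m q by rewrite mxE.
  have E2 : (om *m (Gam k)^T) p q = - \sum_m Gam k q m * om m p.
    rewrite mxE -sumrN; apply: eq_bigr => m _; rewrite [_^T _ _]mxE omE; ring.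
  by rewrite nabla_fundamental -/om !(mxDE, mxNE) E1 E2 [map_mx _ _ _ _]mxE opprK.
have T p q s : \sum_m Gam p q m * om m s = \sum_m Gam q p m * om m s.
  by apply: eq_bigr => m _; rewrite Gam_torsion_free.
rewrite !E (T b a) (T c b) (T a c) -[RHS](closed a b c); ring.
Qed.

Lemma D_J1 k : 'D[k] (J1 : 'M[A]_4) = 0.
Proof.
have D1 : D k 1 = 0 by have /matrixP/(_ o0 o0) := D_1mx k 4; rewrite !mxE.
rewrite /J1 /mx4; apply/matrixP => a b; rewrite !mxE.
move: b; apply: ord4_ind; move: a; apply: ord4_ind; rewrite /= ?raddfN ?D1 ?raddf0 ?oppr0 //.
Qed.

Let Gx x : 'M[R]_4 := map_mx (ev x) g.
Let Jx x : 'M[R]_4 := map_mx (ev x) j.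
Let Rx x a b c d : R := ev x (riem a b c d).
Hypothesis asd : forall x k l,
  self_dual_part (Gx x) (Jx x) (\matrix_(a, b) weyl_of (Gx x) (Rx x) a b k l) = 0.
Hypothesis ricci_J : forall x,
  Jx x *m ricci_of (Gx x) (Rx x) *m (Jx x)^T = ricci_of (Gx x) (Rx x).

Lemma Rx_anti12 x a b c d : Rx x b a c d = - Rx x a b c d.
Proof. by rewrite /Rx riem_anti12 rmorphN. Qed.
Lemma Rx_anti34 x a b c d : Rx x a b d c = - Rx x a b c d.
Proof. by rewrite /Rx riem_anti34 rmorphN. Qed.
Lemma Rx_bianchi x a b c d : Rx x a b c d + Rx x b c a d + Rx x c a b d = 0.
Proof. by rewrite /Rx -!rmorphD riem_bianchi rmorph0. Qed.

Lemma map_J1 x : map_mx (ev x) J1 = J1.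
Proof.
apply/matrixP => a b; rewrite /J1 /mx4 !mxE.
by move: b; apply: ord4_ind; move: a; apply: ord4_ind; rewrite /= ?rmorphN ?rmorph1 ?rmorph0.
Qed.
Lemma ev_J2 x a b : ev x (J2 a b) = J2 a b.
Proof.
rewrite /J2 /mx4 !mxE.
by move: b; apply: ord4_ind; move: a; apply: ord4_ind; rewrite /= ?rmorphN ?rmorph1 ?rmorph0.
Qed.
Lemma ev_J3 x a b : ev x (J3 a b) = J3 a b.
Proof.
rewrite /J3 /mx4 !mxE.
by move: b; apply: ord4_ind; move: a; apply: ord4_ind; rewrite /= ?rmorphN ?rmorph1 ?rmorph0.
Qed.

Section Frame.
Variable E : 'M[A]_4.
Hypothesis EgE : E *m g *m E^T = 1%:M.
Hypothesis Ej : E *m j = J1 *m E.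
Let F := g *m E^T.
Let cn k := conn D Gam E F k.
Local Notation con := (frame_conn D Gam E F).
Local Notation fc := (frame_curv D Gam E F).

Let EF : E *m F = 1%:M. Proof. by rewrite mulmxA. Qed.
Let FE : F *m E = 1%:M. Proof. exact: mulmx1C. Qed.
Let D_E k : 'D[k] E = cn k *m E - E *m Gam k. Proof. exact: D_frame. Qed.

Lemma conn_skew k : (cn k)^T = - cn k.
Proof.
have a1 : 'D[k] E *m g *m E^T = cn k - E *m Gam k *m g *m E^T.
  by rewrite D_E !mulmxBl -!(mulmxA (cn k)) EgE mulmx1.
have a2 : E *m g *m ('D[k] E)^T = (cn k)^T - E *m g *m (Gam k)^T *m E^T.
  by rewrite D_E mx_trD mx_trN !trmx_mul mulmxBr !mulmxA EgE mul1mx.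
have := congr1 (fun M : 'M[A]_4 => 'D[k] M) EgE.
rewrite !(D_mulmx DM) (D_trmx D) metric_compatible D_1mx mulmxDl a1 a2.
rewrite mulmxDr mulmxDl !mulmxA => H; apply/matrixP => a b.
move/matrixP/(_ a b): H; rewrite !(mxDE, mxNE) [fun_of_matrix 0 a b]mxE => H.
by apply: (eq_lincomb H); ring.
Qed.

Lemma frame_nablaJ k : E *m nablaJ k *m F = J1 *m cn k - cn k *m J1.
Proof.
have H := congr1 (fun M : 'M[A]_4 => 'D[k] M) Ej.
rewrite !(D_mulmx DM) D_J1 mul0mx add0r D_E !(mulmxBl, mulmxBr) !mulmxA in H.
rewrite -(mulmxA (cn k)) Ej !mulmxA in H.
have -> : E *m nablaJ k = (J1 *m cn k - cn k *m J1) *m E.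
  rewrite /nablaJ !(mulmxDl, mulmxDr, mulNmx, mulmxN) !mulmxA Ej.
  apply/matrixP => a b; move/matrixP/(_ a b): H; rewrite !(mxDE, mxNE) => H.
  by apply: (eq_lincomb H); ring.
by rewrite -mulmxA EF mulmx1.
Qed.

Lemma con_skew a c d : con a d c = - con a c d.
Proof.
rewrite /frame_conn /contract1 -sumrN; apply: eq_bigr => k _.
by have /matrixP/(_ c d) := conn_skew k; rewrite mxE mxNE => ->; rewrite mulrN.
Qed.

Lemma frame_curv_riem a b c d : fc a b c d = contract4 E riem a b c d.
Proof.
rewrite (contract4_matrix E (fun a b => curv D Gam a b *m g)).
apply: eq_bigr => p _; apply: eq_bigr => q _; congr (_ * _).
have := curv_gauge DM D_comm p q D_E.
move=> /(congr1 (fun M => M *m F)); rewrite -mulmxA EF mulmx1 => ->.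
by rewrite /F !mulmxA.
Qed.

(** The components of the covariant derivative of [j] along the frame, in the
    form that [frame_nablaJ] gives them. *)
Definition frameJ a b c : A :=
  \sum_m (J1 b m * con a m c - con a b m * J1 m c).

Lemma frameJE a b c : frameJ a b c = \sum_k E a k * (E *m (nablaJ k *m g) *m E^T) b c.
Proof.
under [RHS]eq_bigr => k _ do rewrite -[E *m _ *m _]mulmxA -[_ *m g *m _]mulmxA -/F
  mulmxA frame_nablaJ mxDE mxNE !mxE -sumrB mulr_sumr.
rewrite exchange_big; apply: eq_bigr => m _.
rewrite /frame_conn /contract1 mulr_sumr mulr_suml -sumrB; apply: eq_bigr => k _; ring.
Qed.

Lemma frameJ_closed a b c : frameJ a b c + frameJ b c a + frameJ c a b = 0.
Proof.
pose chi p q s := (nablaJ p *m g) q s.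
have JE u v w : frameJ u v w = contract3 E chi u v w.
  rewrite frameJE; apply: eq_bigr => k _; rewrite congr_mxE mulr_sumr.
  apply: eq_bigr => q _; rewrite mulr_sumr; apply: eq_bigr => s _; rewrite /chi; ring.
rewrite !JE -(contract3_rot E chi a b c) -(contract3_rot E chi b c a) -(contract3_rot E _ a b c).
rewrite /contract3 -!big_split big1 // => p _; rewrite -!big_split big1 // => q _.
rewrite -!big_split big1 // => s _ /=; rewrite -!mulrDr [X in _ * X](_ : _ = 0) ?mulr0 //.
exact: nablaJ_closed.
Qed.

Let S1 a := con a o0 o1 + con a o2 o3.
Let S2 a := con a o0 o2 - con a o1 o3.
Let S3 a := con a o0 o3 + con a o1 o2.

Let con_diag a c : con a c c = 0.
Proof. by apply: mulr2n_inj; rewrite mulr2n {1}con_skew addNr. Qed.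

(** [con] is skew, and only its components along [J2] and [J3] fail to commute
    with [J1]. *)
Lemma frameJ_sd a b c : frameJ a b c = S3 a * J2 b c - S2 a * J3 b c.
Proof.
have skews := (con_diag a, con_skew a o0 o1, con_skew a o0 o2, con_skew a o0 o3,
  con_skew a o1 o2, con_skew a o1 o3, con_skew a o2 o3).
rewrite /frameJ /S2 /S3 sum4 ![J1 _ _]mxE [J2 _ _]mxE [J3 _ _]mxE.
by move: c; apply: ord4_ind; move: b; apply: ord4_ind; rewrite /= !skews; ring.
Qed.

(** The four components of the exterior derivative of the fundamental form relate
    the eight components of S2 and S3 in pairs. *)
Lemma closed_sd : [/\ S3 o1 = - S2 o0, S3 o0 = S2 o1, S2 o2 = - S3 o3 & S3 o2 = S2 o3].
Proof.
have H012 := frameJ_closed o0 o1 o2; have H013 := frameJ_closed o0 o1 o3.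
have H023 := frameJ_closed o0 o2 o3; have H123 := frameJ_closed o1 o2 o3.
move: H012 H013 H023 H123; rewrite !frameJ_sd ![J2 _ _]mxE ![J3 _ _]mxE /=.
move=> H012 H013 H023 H123; split.
- by apply: (eq_lincomb (esym H012)); ring.
- by apply: (eq_lincomb (esym H013)); ring.
- by apply: (eq_lincomb H023); ring.
- by apply: (eq_lincomb H123); ring.
Qed.

Let Ex x := map_mx (ev x) E.

Let ExG x : Ex x *m Gx x *m (Ex x)^T = 1%:M.
Proof. by rewrite /Ex /Gx map_trmx -!map_mxM EgE map_mx1. Qed.
Let ExJ x : Ex x *m Jx x = J1 *m Ex x.
Proof. by rewrite /Ex /Jx -map_mxM Ej map_mxM map_J1. Qed.

Lemma ev_frame_curv x a b c d : ev x (fc a b c d) = contract4 (Ex x) (Rx x) a b c d.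
Proof.
rewrite frame_curv_riem /contract4 rmorph_sum; apply: eq_bigr => p _.
rewrite rmorph_sum; apply: eq_bigr => q _; rewrite rmorph_sum; apply: eq_bigr => s _.
by rewrite rmorph_sum; apply: eq_bigr => t _; rewrite !rmorphM !mxE.
Qed.

Let k := fc o0 o2 o0 o2 - fc o0 o2 o1 o3.

Let curv23 x a b :=
  asd_curvature23 (ExG x) (ExJ x) (@Rx_anti12 x) (@Rx_anti34 x) (@Rx_bianchi x)
    (asd x) (ricci_J x) a b.

Let ev_k x : ev x k = - (scalar_of (Gx x) (Rx x) / 12).
Proof.
by rewrite /k rmorphB !ev_frame_curv (curv23 x o0 o2).1 [J2 _ _]mxE mulr1.
Qed.

Lemma frame_curv_sd2 a b : fc a b o0 o2 - fc a b o1 o3 = k * J2 a b.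
Proof.
apply: ev_inj => x; rewrite rmorphB rmorphM ev_J2 ev_k !ev_frame_curv.
exact: (curv23 x a b).1.
Qed.

Lemma frame_curv_sd3 a b : fc a b o0 o3 + fc a b o1 o2 = k * J3 a b.
Proof.
apply: ev_inj => x; rewrite rmorphD rmorphM ev_J3 ev_k !ev_frame_curv.
exact: (curv23 x a b).2.
Qed.

Lemma frame_curv_sd1 :
  let f a b := fc a b o0 o1 + fc a b o2 o3 in
  [/\ f o0 o1 + f o2 o3 = 2 * k, f o0 o2 - f o1 o3 = 0 & f o0 o3 + f o1 o2 = 0].
Proof.
have H x := asd_curvature1 (ExG x) (ExJ x) (@Rx_anti12 x) (@Rx_anti34 x)
  (@Rx_bianchi x) (asd x) (ricci_J x).
split; apply: ev_inj => x; have [H1 H2 H3] := H x.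
- by rewrite rmorphM rmorph_nat ev_k !rmorphD !ev_frame_curv H1.
- by rewrite rmorphB rmorph0 !rmorphD !ev_frame_curv H2.
- by rewrite rmorph0 !rmorphD !ev_frame_curv H3.
Qed.

Lemma nablaJ_frame q s b : \sum_m E b m * (nablaJ m *m g) q s =
  S3 b * (F *m J2 *m F^T) q s - S2 b * (F *m J3 *m F^T) q s.
Proof.
have NE m : nablaJ m *m g = F *m (E *m (nablaJ m *m g) *m E^T) *m F^T.
  by rewrite !mulmxA FE mul1mx -!mulmxA -trmx_mul FE trmx1 !mulmx1.
under eq_bigr => m _ do rewrite NE congr_mxE mulr_sumr.
rewrite !congr_mxE !mulr_sumr -sumrB exchange_big; apply: eq_bigr => u _.
under eq_bigr => m _ do rewrite mulr_sumr.
rewrite !mulr_sumr -sumrB exchange_big; apply: eq_bigr => v _.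
have -> : \sum_m E b m * (F q u * F s v * (E *m (nablaJ m *m g) *m E^T) u v) =
    F q u * F s v * frameJ b u v.
  by rewrite frameJE mulr_sumr; apply: eq_bigr => m _; ring.
rewrite frameJ_sd; ring.
Qed.

(** The first hypothesis says that e0 is dual to a component of the covariant
    derivative of J; the second one that the derivative of J in the direction e0,
    applied to e0, has no component along e3, so that S2 vanishes on e0.  Together with the
    closedness of the fundamental form they give S3 = r e^0 and S2 = r e^1. *)
Lemma gauged_frame_absurd (h : A) q s :
  (forall b, h * \sum_m E b m * (nablaJ m *m g) q s = (b == o0)%:R) ->
  frameJ o0 o0 o3 = 0 -> X -> False.
Proof.
move=> dual J003; pose r := S3 o0.
have S20 : S2 o0 = 0.
  by move: J003; rewrite frameJ_sd [J2 _ _]mxE [J3 _ _]mxE /= mulr0 mulr1 sub0r => /eqP;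
    rewrite oppr_eq0 => /eqP.
have [c1 c2 c3 c4] := closed_sd.
move: dual; set P := (F *m J2 *m F^T) q s; set Q := (F *m J3 *m F^T) q s => dual.
have {}dual b : h * (S3 b * P - S2 b * Q) = (b == o0)%:R.
  by rewrite -dual nablaJ_frame.
have u : h * r * P = 1.
  by have := dual o0; rewrite S20 mul0r subr0 mulrA.
have S31 : S3 o1 = 0 by rewrite c1 S20 oppr0.
have Q0 : Q = 0.
  have := dual o1; rewrite S31 mul0r sub0r -c2 /= => H.
  by rewrite -[Q]mul1r -u; apply: (eq_lincomb (congr1 (fun a => - (P * a)) H)); rewrite /r; ring.
have S3z b : b != o0 -> S3 b = 0.
  move=> /negPf b0; have := dual b; rewrite Q0 mulr0 subr0 b0 /= => H.
  by rewrite -[S3 b]mul1r -u; apply: (eq_lincomb (congr1 (fun a => r * a) H)); rewrite /r; ring.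
have [f1 f2 f3] := frame_curv_sd1.
apply: (@adapted_frame_absurd R A X ev ev_inj (frame_deriv D E) _ _ con _ fc _ _ _ _ _ _
  S1 S2 S3 _ _ _ k _ _ f1 f2 f3 r).
- by move=> i a b; rewrite raddfB.
- exact: frame_derivM.
- by move=> a b f; exact: (frame_deriv_comm DM D_comm Gam_torsion_free FE).
- by move=> a b c d; exact: (frame_curvE DM Gam_torsion_free FE).
- by move=> a b c d; rewrite !frame_curv_riem; apply: contract4_bianchi; exact: riem_bianchi.
- by move=> a b c d e; exact: (frame_differential_bianchi DM D_comm Gam_torsion_free FE).
- exact: con_skew.
- by move=> a b c d; rewrite !frame_curv_riem; apply: contract4_anti12; exact: riem_anti12.
- by move=> a b c d; rewrite !frame_curv_riem; apply: contract4_anti34; exact: riem_anti34.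
- by [].
- by [].
- by [].
- exact: frame_curv_sd2.
- exact: frame_curv_sd3.
- move=> x; have := congr1 (ev x) u; rewrite !rmorphM rmorph1 => {}u.
  by apply/eqP => r0; move/eqP: u; rewrite r0 mulr0 mul0r eq_sym oner_eq0.
- by apply: ord4_ind; rewrite /= ?mulr0n ?mulr1n // ?c3 -?c4 S3z ?oppr0.
- by apply: ord4_ind; rewrite /= ?mulr0n ?mulr1n // S3z.
Qed.

End Frame.

Let Gx_sym x : (Gx x)^T = Gx x.
Proof. by rewrite /Gx map_trmx g_sym. Qed.
Let Jx_sqr x : Jx x *m Jx x = - 1%:M.
Proof. by rewrite /Jx -map_mxM j_sqr map_mxN map_mx1. Qed.
Let Jx_orth x : Jx x *m Gx x *m (Jx x)^T = Gx x.
Proof. by rewrite /Jx /Gx map_trmx -!map_mxM j_orth. Qed.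
Let Gx_pos x (v : 'rV[R]_4) : v != 0 -> 0 < (v *m Gx x *m v^T) 0 0.
Proof. exact: g_pos. Qed.

Lemma J1_tr : (J1 : 'M[R]_4)^T = - J1.
Proof.
apply/matrixP => a b; rewrite mxE mxNE /J1 /mx4 !mxE.
by move: b; apply: ord4_ind; move: a; apply: ord4_ind; rewrite /=; ring.
Qed.

Lemma JG_skew x : Gx x *m (Jx x)^T = - (Jx x *m Gx x).
Proof.
rewrite -(fundamental_skew (Gx_sym x) (Jx_sqr x) (Jx_orth x)).
by rewrite trmx_mul Gx_sym.
Qed.

(** A parallel J commutes with the curvature, so that the curvature has no
    component along [J2]; for an anti-self-dual metric with J-invariant Ricci
    tensor this component is a multiple of the scalar curvature. *)
Lemma parallel_scalar_flat x : (forall k, nablaJ k = 0) -> scalar_of (Gx x) (Rx x) = 0.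
Proof.
move=> parallel.
have v0 : (delta_mx 0 o0 : 'rV[R]_4) != 0.
  apply/eqP => /matrixP/(_ 0 o0); rewrite !mxE eqxx => /eqP; rewrite oner_eq0.
  by [].
have [a _ uu] := exists_unit (Gx_pos x) v0.
have [E [EGE EJ _]] := exists_hermitian_frame (Gx_sym x) (Gx_pos x) (Jx_sqr x) (Jx_orth x) uu.
have := (asd_curvature23 EGE EJ (@Rx_anti12 x) (@Rx_anti34 x) (@Rx_bianchi x)
    (asd x) (ricci_J x) o0 o2).1.
pose C p q : 'M[R]_4 := map_mx (ev x) (curv D Gam p q *m g).
have CE p q c d : Rx x p q c d = C p q c d by rewrite [RHS]mxE.
have comm p q : (E *m C p q *m E^T) o0 o2 = (E *m C p q *m E^T) o1 o3.
  have Dj k : 'D[k] j = Gam k *m j - j *m Gam k.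
    apply/eqP; rewrite -subr_eq0 opprB addrA -/(nablaJ k); apply/eqP; exact: parallel.
  have cj := curv_gauge DM D_comm p q Dj.
  set M := E *m C p q *m E^T.
  have MJ : J1 *m M = M *m J1.
    have JC : Jx x *m C p q = - (C p q *m (Jx x)^T).
      rewrite /C map_mxM -/(Gx x) -mulmxA JG_skew mulmxN opprK !mulmxA.
      by rewrite /Jx -!map_mxM cj.
    transitivity (E *m (Jx x *m C p q) *m E^T); first by rewrite !mulmxA EJ.
    rewrite JC mulmxN mulNmx -!mulmxA -trmx_mul EJ trmx_mul J1_tr.
    by rewrite !mulmxN opprK !mulmxA.
  have /matrixP/(_ o0 o3) := MJ; rewrite [LHS]mxE [RHS]mxE !sum4 ![J1 _ _]mxE /=.
  by move: (M o0 o2) (M o1 o3) => m n E1; apply: (eq_lincomb (esym E1)); ring.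
rewrite [J2 _ _]mxE /= mulr1.
have trE c d : contract4 E (Rx x) o0 o2 c d =
    \sum_p \sum_q E o0 p * E o2 q * (E *m C p q *m E^T) c d.
  rewrite -contract4_matrix; exact: eq_contract4 (CE).
rewrite !trE; under [X in _ - X = _]eq_bigr => p _ do under eq_bigr => q _ do rewrite -comm.
by rewrite subrr; move: (scalar_of _ _) => s0; lra.
Qed.

(** In a Hermitian frame [N *m Gx x] is a skew matrix that anticommutes with
    [J1], hence a combination of [J2] and [J3]; unless it vanishes, such a
    combination is invertible. *)
Lemma antilinear_skew_eq0 x (N : 'M[R]_4) (u : 'rV[R]_4) :
  pairing (Gx x) u u = 1 -> N *m Jx x = - (Jx x *m N) ->
  (N *m Gx x)^T = - (N *m Gx x) -> u *m N = 0 -> N *m Gx x = 0.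
Proof.
move=> uu NJ NGs uN.
have [E [EGE EJ Eu]] := exists_hermitian_frame (Gx_sym x) (Gx_pos x) (Jx_sqr x) (Jx_orth x) uu.
set M := E *m (N *m Gx x) *m E^T.
have skew : M^T = - M.
  by rewrite /M trmx_mul [(E *m _)^T]trmx_mul trmxK NGs mulNmx mulmxN mulmxA.
have MJ : J1 *m M = - (M *m J1).
  transitivity (E *m (Jx x *m N *m Gx x) *m E^T); first by rewrite /M !mulmxA EJ.
  have -> : Jx x *m N *m Gx x = N *m Gx x *m (Jx x)^T.
    by rewrite -[RHS]mulmxA JG_skew mulmxN mulmxA NJ mulNmx opprK.
  have JE : (Jx x)^T *m E^T = - (E^T *m J1) by rewrite -trmx_mul EJ trmx_mul J1_tr mulmxN.
  by rewrite /M -!mulmxA JE !mulmxN.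
have row0 b : M o0 b = 0.
  have -> : M o0 b = (row o0 M) 0 b by rewrite [RHS]mxE.
  by rewrite /M !row_mul Eu !mulmxA uN !mul0mx mxE.
have sk a b : M b a = - M a b by have /matrixP/(_ a b) := skew; rewrite mxE mxNE.
have MJ0 a b : (J1 *m M) a b + (M *m J1) a b = 0 by rewrite MJ mxNE addNr.
have row1 b : M o1 b = 0.
  have := MJ0 o0 b; rewrite mxE [X in _ + X]mxE !sum4 ![J1 _ _]mxE /= !row0.
  by move: (M o1 b) => t; lra.
have M23 : M o2 o3 = 0.
  have := MJ0 o2 o2; rewrite mxE [X in _ + X]mxE !sum4 ![J1 _ _]mxE /= (sk o2 o3).
  by move: (M o2 o3) (M o2 o0) (M o2 o1) (M o0 o2) (M o1 o2) (M o2 o2) => *; lra.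
have diag a : M a a = 0 by have := sk a a; lra.
have M0 : M = 0.
  apply/matrixP; apply: ord4_ind => b; rewrite [RHS]mxE ?row0 ?row1 //;
    by move: b; apply: ord4_ind; rewrite ?(sk o0) ?(sk o1) ?(sk o2 o3) ?row0 ?row1 ?diag ?M23 ?oppr0.
have uE := frame_unit EGE.
have uET : E^T \in unitmx by rewrite unitmx_tr.
have <- : invmx E *m M *m invmx E^T = N *m Gx x.
  by rewrite /M -[E *m _ *m _]mulmxA mulKmx // mulmxK.
by rewrite M0 mulmx0 mul0mx.
Qed.

(** The unit vector e0 is taken along the gradient dual to the nonvanishing
    component, and e2 along the derivative of J in the direction e0, applied to e0.
    The latter vector is nonzero by [antilinear_skew_eq0], and it is orthogonal to
    e0 and J e0 because the derivative of J is skew and anticommutes with J. *)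
Lemma nablaJ_nowhere_absurd i0 q s :
  (forall x, ev x ((nablaJ i0 *m g) q s) != 0) -> X -> False.
Proof.
move=> nz.
pose al : 'rV[A]_4 := \row_m (nablaJ m *m g) q s.
pose grad := al *m gi.
have gradg : grad *m g = al by rewrite -mulmxA (mulmx1C g_gi) mulmx1.
have pair_pos x (v : 'rV[A]_4) : map_mx (ev x) v != 0 -> 0 < ev x (pairing g v v).
  move=> /(@Gx_pos x); rewrite /pairing /Gx map_trmx -!map_mxM.
  by rewrite [X in 0 < X]mxE.
have pairZ a (v w : 'rV[A]_4) : pairing g (a *: v) w = a * pairing g v w.
  by rewrite /pairing -!scalemxAl mxE.
have pairZr a (v w : 'rV[A]_4) : pairing g v (a *: w) = a * pairing g v w.
  by rewrite /pairing linearZ /= -scalemxAr mxE.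
have [h1 h1E _] : exists2 h : A, h * h * pairing g grad grad = 1 & forall x, 0 < ev x h.
  apply: exists_rsqrt => x; apply: pair_pos; apply: contraNneq (nz x) => grad0.
  have alx : map_mx (ev x) al = 0 by rewrite -gradg map_mxM grad0 mul0mx.
  by have /matrixP/(_ 0 i0) := alx; rewrite mxE [al _ _]mxE [RHS]mxE => ->.
pose u := h1 *: grad.
have uu : pairing g u u = 1 by rewrite pairZ pairZr mulrA.
have ug : u *m g = h1 *: al by rewrite -scalemxAl gradg.
pose N := \sum_m u 0 m *: nablaJ m.
have Nj : N *m j = - (j *m N).
  rewrite /N mulmx_suml mulmx_sumr -sumrN; apply: eq_bigr => m _.
  by rewrite -scalemxAl -scalemxAr nablaJ_anticomm scalerN.
have Ng : (N *m g)^T = - (N *m g).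
  rewrite /N mulmx_suml raddf_sum -sumrN; apply: eq_bigr => m _ /=.
  by rewrite -scalemxAl linearZ /= nablaJg_skew scalerN.
have gN : g *m N^T = - (N *m g) by rewrite -Ng trmx_mul g_sym.
have Njg : (N *m j *m g)^T = - (N *m j *m g).
  transitivity (j *m N *m g); last by rewrite Nj mulNmx opprK.
  by rewrite -[N *m j *m g]mulmxA trmx_mul jg_skew mulNmx -[j *m g *m _]mulmxA gN mulmxN opprK mulmxA.
have Nqs : h1 * (N *m g) q s = 1.
  rewrite -uu /pairing ug -scalemxAl [RHS]mxE; congr (_ * _).
  rewrite /N mulmx_suml summxE [RHS]mxE; apply: eq_bigr => m _.
  by rewrite -scalemxAl !mxE mulrC.
pose v := u *m N.
have [h2 h2E _] : exists2 h : A, h * h * pairing g v v = 1 & forall x, 0 < ev x h.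
  apply: exists_rsqrt => x; apply: pair_pos; apply/eqP => v0.
  have NG0 : map_mx (ev x) N *m Gx x = 0.
    apply: (@antilinear_skew_eq0 x _ (map_mx (ev x) u)).
    - by rewrite /pairing map_trmx /Gx -!map_mxM mxE -/(pairing g u u) uu rmorph1.
    - by rewrite /Jx -!map_mxM Nj map_mxN.
    - by rewrite /Gx -map_mxM map_trmx Ng map_mxN.
    - by rewrite -map_mxM.
  have := congr1 (ev x) Nqs; rewrite rmorphM rmorph1 => /eqP.
  have -> : ev x ((N *m g) q s) = (map_mx (ev x) N *m Gx x) q s.
    by rewrite /Gx -map_mxM [RHS]mxE.
  by rewrite NG0 mxE mulr0 eq_sym oner_eq0.
pose w := h2 *: v.
have ww : pairing g w w = 1 by rewrite pairZ pairZr mulrA.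
have uw : pairing g u w = 0.
  rewrite pairZr pairing_sym // /pairing /v -(mulmxA u).
  by rewrite (skew_pairing mulr2n_inj) ?mulr0.
have juw : pairing g (u *m j) w = 0.
  rewrite pairZr pairing_sym // /pairing /v trmx_mul mulmxA.
  have -> : u *m N *m g *m j^T = - (u *m (N *m j *m g)).
    have -> : N *m j *m g = - (N *m g *m j^T).
      by rewrite -mulmxA -[j *m g]opprK -jg_skew trmx_mul g_sym mulmxN mulmxA.
    by rewrite mulmxN opprK !mulmxA.
  by rewrite mulNmx mxNE (skew_pairing mulr2n_inj) ?oppr0 ?mulr0.
have EgE := hermitian_frame_orthonormal mulr2n_inj g_sym j_sqr j_orth uu ww uw juw.
have Ej := hermitian_frame_j j_sqr u w.
set E := rows4 _ _ _ _ in EgE Ej.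
apply: (@gauged_frame_absurd E EgE Ej h1 q s).
  move=> b; have /matrixP/(_ o0 b) := EgE; rewrite [fun_of_matrix 1%:M _ _]mxE eq_sym => <-.
  have Eg0 m : (E *m g) o0 m = h1 * (nablaJ m *m g) q s.
    have -> : (E *m g) o0 m = (row o0 (E *m g)) 0 m by rewrite [RHS]mxE.
    by rewrite row_mul rowK /= ug !mxE.
  rewrite [RHS]mxE mulr_sumr; apply: eq_bigr => m _.
  by rewrite Eg0 [E^T _ _]mxE; ring.
rewrite (frameJE EgE Ej).
have E0 m : E o0 m = u 0 m.
  have -> : E o0 m = (row o0 E) 0 m by rewrite [RHS]mxE.
  by rewrite rowK.
transitivity ((E *m (N *m g) *m E^T) o0 o3).
  rewrite /N mulmx_suml mulmx_sumr mulmx_suml summxE; apply: eq_bigr => m _.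
  by rewrite E0 -!(scalemxAl, scalemxAr) [RHS]mxE.
have -> : (E *m (N *m g) *m E^T) o0 o3 = pairing g v (w *m j).
  rewrite [LHS]mxE /pairing [RHS]mxE; apply: eq_bigr => m _.
  congr (_ * _); last by rewrite !mxE.
  have -> : (E *m (N *m g)) o0 m = (row o0 (E *m (N *m g))) 0 m by rewrite [RHS]mxE.
  by rewrite row_mul rowK /= mulmxA.
by rewrite -scalemxAl pairZr pairing_sym // (pairing_ju mulr2n_inj) ?mulr0.
Qed.

End AlmostKaehlerRing.

(** * From charts to the ring of smooth functions *)

Lemma posdef_unit (R : realType) (G : 'M[R]_4) :
  (forall v : 'rV[R]_4, v != 0 -> 0 < (v *m G *m v^T) 0 0) -> G \in unitmx.
Proof.
move=> pos; rewrite unitmxE unitfE; apply/negP => /det0P[v v0 vG].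
by have := pos v v0; rewrite vG mul0mx mxE ltxx.
Qed.

Section Chart.
Variables (R : realType) (V : set 'rV[R]_4) (oV : open V).
Variables (G J : 'rV[R]_4 -> 'M[R]_4).
Hypothesis G_smooth : smooth_on V G.
Hypothesis J_smooth : smooth_on V J.
Hypothesis G_sym : forall x, V x -> (G x)^T = G x.
Hypothesis G_pos : forall x, V x ->
  forall v : 'rV[R]_4, v != 0 -> 0 < (v *m G x *m v^T) 0 0.
Hypothesis J_sqr : forall x, V x -> J x *m J x = - 1%:M.
Hypothesis J_orth : forall x, V x -> J x *m G x *m (J x)^T = G x.
Hypothesis closed : forall x, V x ->
  forall a b c, ext_deriv2 (fun y => J y *m G y) a b c x = 0.
Hypothesis asd : forall x, V x -> forall a b c d, weyl_plus G J a b c d x = 0.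
Hypothesis ricci_J : forall x, V x -> J x *m ricci G x *m (J x)^T = ricci G x.

Let pt := {x : 'rV[R]_4 | V x}.

(** The smooth functions on V are used only through these properties, so that no
    computation unfolds their concrete ring. *)
Variables (A : comPzRingType) (evp : pt -> {rmorphism A -> R}).
Variable D : 'I_4 -> {additive A -> A}.
Hypothesis evp_inj : forall a b : A, (forall s, evp s a = evp s b) -> a = b.
Hypothesis lift_smooth : forall f : 'rV[R]_4 -> R, smooth_on V f ->
  {a : A | forall s, evp s a = f (sval s)}.
Hypothesis evp_rsqrt : forall a : A, (forall s, 0 < evp s a) ->
  exists2 h : A, h * h * a = 1 & forall s, 0 < evp s h.
Hypothesis DM : forall i a b, D i (a * b) = D i a * b + a * D i b.
Hypothesis D_comm : forall i j a, D i (D j a) = D j (D i a).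
Hypothesis ev_D : forall k a f, (forall s, evp s a = f (sval s)) ->
  forall s, evp s (D k a) = pder k f (sval s).

Definition smoothmx (F : 'rV[R]_4 -> 'M[R]_4) (sF : smooth_on V F) : 'M[A]_4 :=
  \matrix_(a, b) sval (lift_smooth (smooth_entry oV a b sF)).

Lemma ev_entry F (sF : smooth_on V F) a b s : evp s (smoothmx sF a b) = F (sval s) a b.
Proof. by rewrite mxE; exact: svalP (lift_smooth _) s. Qed.

Lemma ev_smoothmx F (sF : smooth_on V F) (s : pt) :
  map_mx (evp s) (smoothmx sF) = F (sval s).
Proof. by apply/matrixP => a b; rewrite mxE ev_entry. Qed.

Lemma ev_D_smoothmx F (sF : smooth_on V F) k a b (s : pt) :
  evp s (D k (smoothmx sF a b)) = pder k (fun y => F y a b) (sval s).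
Proof. by apply: (@ev_D k _ (fun y => F y a b)) => t; exact: ev_entry. Qed.

Let g := smoothmx G_smooth.
Let j := smoothmx J_smooth.
Let half : A := sval (lift_smooth (smooth_cst oV 2^-1)).

Let ev_half s : evp s half = 2^-1.
Proof. exact: svalP (lift_smooth (smooth_cst oV 2^-1)) s. Qed.

Let half2 : half *+ 2 = 1.
Proof.
apply: evp_inj => s; rewrite rmorphMn rmorph1 ev_half -mulr_natr mulVf //.
Qed.

Let mx_inj (M N : 'M[A]_4) : (forall s, map_mx (evp s) M = map_mx (evp s) N) -> M = N.
Proof.
move=> MN; apply/matrixP => a b; apply: evp_inj => s.
by have /matrixP/(_ a b) := MN s; rewrite !mxE.
Qed.

Let g_sym : g^T = g.
Proof.
apply: mx_inj => s; rewrite -map_trmx !ev_smoothmx; exact: G_sym (svalP s).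
Qed.

Let exists_gi : exists gi : 'M[A]_4, g *m gi = 1%:M.
Proof.
(* The square of det g is positive, so that h^2 det g inverts det g. *)
have [h hE _] : exists2 h : A, h * h * (\det g * \det g) = 1 & forall s, 0 < evp s h.
  apply: evp_rsqrt => s; rewrite rmorphM -expr2 -det_map_mx ev_smoothmx.
  rewrite exprn_even_gt0 //= -unitfE -unitmxE.
  exact: posdef_unit (G_pos (svalP s)).
exists ((h * h * \det g) *: \adj g).
rewrite -scalemxAr mul_mx_adj scale_scalar_mx; congr (_%:M).
by rewrite -[RHS]hE; ring.
Qed.

Definition christoffel_mx k x : 'M[R]_4 := \matrix_(a, l) christoffel G l k a x.

Definition nabla_acs k x : 'M[R]_4 :=
  (\matrix_(a, b) pder k (fun y => J y a b) x)
  + J x *m christoffel_mx k x - christoffel_mx k x *m J x.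

Section Inverse.
Variable gi : 'M[A]_4.
Hypothesis g_gi : g *m gi = 1%:M.

Let Gm := Gam D g gi half.

Let ev_gi (s : pt) : map_mx (evp s) gi = invmx (G (sval s)).
Proof.
have uG : G (sval s) \in unitmx := posdef_unit (G_pos (svalP s)).
have H : G (sval s) *m map_mx (evp s) gi = 1%:M.
  by rewrite -(ev_smoothmx G_smooth) -map_mxM g_gi map_mx1.
by rewrite -[LHS](mulKmx uG) H mulmx1.
Qed.

Let ev_Gm k a l (s : pt) : evp s (Gm k a l) = christoffel G l k a (sval s).
Proof.
rewrite /Gm /Gam mxE rmorphM ev_half mxE rmorph_sum /christoffel; congr (_ * _).
apply: eq_bigr => m _; rewrite rmorphM [RHS]mulrC.
have -> : evp s (gi^T m l) = invmx (G (sval s)) l m.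
  by have /matrixP/(_ l m) := ev_gi s; rewrite !mxE.
by rewrite mxE rmorphB rmorphD !ev_D_smoothmx.
Qed.

Let ev_D_Gm i k a l (s : pt) :
  evp s (D i (Gm k a l)) = pder i (christoffel G l k a) (sval s).
Proof.
exact: (@ev_D i _ (christoffel G l k a) (ev_Gm k a l)).
Qed.

Let ev_curv a b c d (s : pt) :
  evp s (curv D Gm a b c d) = riemann_up G d a b c (sval s).
Proof.
rewrite rmorph_curv !ev_D_Gm.
congr (_ + _); apply: eq_bigr => m _.
by rewrite !ev_Gm.
Qed.

Let ev_riem a b c d (s : pt) :
  evp s (riem D g gi half a b c d) = riemann G a b c d (sval s).
Proof.
rewrite /riem mxE rmorph_sum; apply: eq_bigr => m _; rewrite rmorphM ev_curv.
by congr (_ * _); have /matrixP/(_ m d) := ev_smoothmx G_smooth s; rewrite mxE.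
Qed.

Let ricciE x : V x -> ricci_of (G x) (fun a b c d => riemann G a b c d x) = ricci G x.
Proof.
move=> Vx; have uG := posdef_unit (G_pos Vx).
have GE a b : G x a b = G x b a by rewrite -{1}(G_sym Vx) mxE.
apply/matrixP => b c; rewrite [LHS]mxE [RHS]mxE; apply: eq_bigr => i _.
under eq_bigr => l _ do rewrite /riemann mulr_sumr.
rewrite exchange_big /=.
transitivity (\sum_m riemann_up G m i b c x * (i == m)%:R).
  apply: eq_bigr => m _.
  have /matrixP/(_ i m) := mulVmx uG; rewrite mxE [RHS]mxE => <-.
  by rewrite mulr_sumr; apply: eq_bigr => l _; rewrite (GE m l); ring.
rewrite (bigD1 i) //= eqxx mulr1 big1 ?addr0 // => m /negPf mi.
by rewrite eq_sym mi mulr0.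
Qed.

Let scalarE x : V x ->
  scalar_of (G x) (fun a b c d => riemann G a b c d x) = scalar_curvature G x.
Proof. by move=> Vx; rewrite /scalar_of ricciE. Qed.

Let weylE x a b c d : V x ->
  weyl_of (G x) (fun a b c d => riemann G a b c d x) a b c d = weyl G a b c d x.
Proof.
move=> Vx; rewrite /weyl_of /weyl ricciE // scalarE //.
have -> : (4%:R - 2 : R)^-1 = 2^-1 by congr (_^-1); ring.
by have -> : (4%:R - 1) * (4%:R - 2) = 6 :> R by ring.
Qed.

Let Rx s := (fun a b c d => evp s (riem D g gi half a b c d)).

Let RxE s : Rx s = (fun a b c d => riemann G a b c d (sval s)).
Proof. by do 4!(apply/funext => ?); exact: ev_riem. Qed.

Let j_sqr : j *m j = - 1%:M.
Proof.
by apply: mx_inj => s; rewrite map_mxM map_mxN map_mx1 ev_smoothmx J_sqr //; exact: svalP.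
Qed.

Let j_orth : j *m g *m j^T = g.
Proof.
by apply: mx_inj => s; rewrite !map_mxM -map_trmx !ev_smoothmx J_orth //; exact: svalP.
Qed.

Let jg_entry a b s : evp s ((j *m g) a b) = (J (sval s) *m G (sval s)) a b.
Proof.
by rewrite -(ev_smoothmx J_smooth) -(ev_smoothmx G_smooth) -map_mxM [RHS]mxE.
Qed.

Let jg_closed a b c :
  D a ((j *m g) b c) + D b ((j *m g) c a) + D c ((j *m g) a b) = 0.
Proof.
apply: evp_inj => s; rewrite !rmorphD rmorph0.
rewrite (@ev_D a _ (fun y => (J y *m G y) b c)); last exact: jg_entry.
rewrite (@ev_D b _ (fun y => (J y *m G y) c a)); last exact: jg_entry.
rewrite (@ev_D c _ (fun y => (J y *m G y) a b)); last exact: jg_entry.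
exact: (closed (svalP s)).
Qed.

Let ev_asd s k l : self_dual_part (map_mx (evp s) g) (map_mx (evp s) j)
  (\matrix_(a, b) weyl_of (map_mx (evp s) g) (Rx s) a b k l) = 0.
Proof.
rewrite RxE !ev_smoothmx; apply/matrixP => a b; rewrite [RHS]mxE.
rewrite -[RHS](asd (svalP s) a b k l) /weyl_plus.
congr (self_dual_part _ _ _ _ _); apply/matrixP => u v; rewrite !mxE.
exact: weylE (svalP s).
Qed.

Let ev_ricci s : map_mx (evp s) j *m ricci_of (map_mx (evp s) g) (Rx s)
  *m (map_mx (evp s) j)^T = ricci_of (map_mx (evp s) g) (Rx s).
Proof. by rewrite RxE !ev_smoothmx ricciE ?ricci_J //; exact: svalP. Qed.

Let ev_pos s (v : 'rV[R]_4) : v != 0 -> 0 < (v *m map_mx (evp s) g *m v^T) 0 0.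
Proof. rewrite ev_smoothmx; exact: G_pos (svalP s) v. Qed.

Lemma ev_nablaJ k s : map_mx (evp s) (nablaJ D g gi j half k) = nabla_acs k (sval s).
Proof.
rewrite /nablaJ map_mxB map_mxD !map_mxM ev_smoothmx /nabla_acs.
have -> : map_mx (evp s) (Gm k) = christoffel_mx k (sval s).
  by apply/matrixP => a l; rewrite mxE ev_Gm [RHS]mxE.
congr (_ + _ - _); apply/matrixP => a b.
by rewrite [RHS]mxE -(ev_D_smoothmx J_smooth) [LHS]mxE [map_mx (D k) j a b]mxE.
Qed.

Lemma ev_nablaJ_g k a b s :
  evp s ((nablaJ D g gi j half k *m g) a b) = (nabla_acs k (sval s) *m G (sval s)) a b.
Proof. by rewrite -ev_nablaJ -(ev_smoothmx G_smooth) -map_mxM [RHS]mxE. Qed.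

Lemma nabla_acs_absurd_of_inverse i a b :
  (forall x, V x -> (nabla_acs i x *m G x) a b != 0) -> forall x, V x -> False.
Proof.
move=> nz x Vx.
have nz' s : evp s ((nablaJ D g gi j half i *m g) a b) != 0.
  by rewrite ev_nablaJ_g; apply: nz; exact: svalP.
exact: (nablaJ_nowhere_absurd evp_inj evp_rsqrt DM D_comm half2 g_sym g_gi j_sqr
  j_orth ev_pos jg_closed ev_asd ev_ricci nz' (exist _ x Vx)).
Qed.

Lemma parallel_scalar_curvature_of_inverse : (forall k x, V x -> nabla_acs k x = 0) ->
  forall x, V x -> scalar_curvature G x = 0.
Proof.
move=> par x Vx; pose s : pt := exist _ x Vx.
have par' k : nablaJ D g gi j half k = 0.
  by apply: mx_inj => t; rewrite ev_nablaJ par ?map_mx0 //; exact: svalP.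
have := parallel_scalar_flat DM D_comm half2 g_sym g_gi j_sqr
  j_orth ev_pos ev_asd ev_ricci s par'.
by rewrite -/(Rx s) RxE ev_smoothmx scalarE.
Qed.

End Inverse.

Lemma nabla_acs_entry i a b : exists f : A,
  forall s, evp s f = (nabla_acs i (sval s) *m G (sval s)) a b.
Proof.
by have [gi g_gi] := exists_gi; exists ((nablaJ D g gi j half i *m g) a b); exact: ev_nablaJ_g.
Qed.

Lemma nabla_acs_nowhere_absurd i a b :
  (forall x, V x -> (nabla_acs i x *m G x) a b != 0) -> forall x, V x -> False.
Proof.
by have [gi g_gi] := exists_gi => nz x Vx; exact: (nabla_acs_absurd_of_inverse g_gi nz Vx).
Qed.

Lemma parallel_scalar_curvature : (forall k x, V x -> nabla_acs k x = 0) ->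
  forall x, V x -> scalar_curvature G x = 0.
Proof.
by have [gi g_gi] := exists_gi => par x Vx; exact: (parallel_scalar_curvature_of_inverse g_gi par Vx).
Qed.

End Chart.

Section SmoothPresentation.
Variables (R : realType) (V : set 'rV[R]_4) (oV : open V).
Local Notation A := (smoothfun oV).
Local Notation pt := {x : 'rV[R]_4 | V x}.

Definition evp (s : pt) : {rmorphism A -> R} := ev (svalP s).
Definition Dr (i : 'I_4) : {additive A -> A} := @sderiv R 4 V oV i.

Lemma evp_inj (a b : A) : (forall s, evp s a = evp s b) -> a = b.
Proof. by move=> ab; apply: evP => x Vx; exact: (ab (exist _ x Vx)). Qed.

Lemma evp_rsqrt (a : A) : (forall s, 0 < evp s a) ->
  exists2 h : A, h * h * a = 1 & forall s, 0 < evp s h.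
Proof.
move=> a0; have [h hE h0] : exists2 h : A, h * h * a = 1 & forall x (Vx : V x), 0 < ev Vx h.
  by apply: exists_rsqrt => x Vx; exact: (a0 (exist _ x Vx)).
by exists h => // s; exact: h0.
Qed.

Lemma lift_smooth f : smooth_on V f -> {a : A | forall s, evp s a = f (sval s)}.
Proof. by move=> sf; exists (tosmooth oV sf) => s; exact: (tosmoothE oV sf (svalP s)). Qed.

Lemma Dr_mul i (a b : A) : Dr i (a * b) = Dr i a * b + a * Dr i b.
Proof. exact: sderivM. Qed.

Lemma Dr_comm i j (a : A) : Dr i (Dr j a) = Dr j (Dr i a).
Proof. exact: sderiv_comm. Qed.

Lemma evp_Dr k (a : A) f : (forall s, evp s a = f (sval s)) ->
  forall s, evp s (Dr k a) = pder k f (sval s).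
Proof.
move=> fa s; transitivity (pder k a (sval s)); first exact: ev_sderiv.
by apply: (pder_eq_on oV) (svalP s) => y Vy; exact: (fa (exist _ y Vy)).
Qed.

End SmoothPresentation.

Section LocalTheorem.
Variables (R : realType) (V : set 'rV[R]_4) (oV : open V).
Variables (G J : 'rV[R]_4 -> 'M[R]_4).
Hypothesis G_smooth : smooth_on V G.
Hypothesis J_smooth : smooth_on V J.
Hypothesis G_sym : forall x, V x -> (G x)^T = G x.
Hypothesis G_pos : forall x, V x ->
  forall v : 'rV[R]_4, v != 0 -> 0 < (v *m G x *m v^T) 0 0.
Hypothesis J_sqr : forall x, V x -> J x *m J x = - 1%:M.
Hypothesis J_orth : forall x, V x -> J x *m G x *m (J x)^T = G x.
Hypothesis closed : forall x, V x ->
  forall a b c, ext_deriv2 (fun y => J y *m G y) a b c x = 0.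
Hypothesis asd : forall x, V x -> forall a b c d, weyl_plus G J a b c d x = 0.
Hypothesis ricci_J : forall x, V x -> J x *m ricci G x *m (J x)^T = ricci G x.

(** Where a component of the covariant derivative is nonzero, it is nonzero on a
    smaller open set, to which [nabla_acs_nowhere_absurd] applies. *)
Lemma acs_parallel k x : V x -> nabla_acs G J k x = 0.
Proof.
move=> Vx; apply/eqP/negPn/negP => nz.
have [a [b nzab]] : exists a b, (nabla_acs G J k x *m G x) a b != 0.
  apply/not_existsP => H; move/negP: nz; apply; apply/eqP.
  rewrite -[LHS](mulmxK (posdef_unit (G_pos Vx))).
  suff -> : nabla_acs G J k x *m G x = 0 by rewrite mul0mx.
  apply/matrixP => a b; rewrite [RHS]mxE; apply/eqP/negPn/negP => nab.
  by apply: (H a); exists b.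
have [f fE] := nabla_acs_entry oV G_smooth J_smooth G_pos
  (@lift_smooth R V oV) (@evp_rsqrt R V oV) (@evp_Dr R V oV) k a b.
have fV y : V y -> f y = (nabla_acs G J k y *m G y) a b.
  by move=> Vy; exact: (fE (exist _ y Vy)).
pose V' := V `&` [set y | f y != 0].
have oV' : open V'.
  rewrite openE => y [Vy fy]; apply: filterI; first exact: (open_nbhs_nbhs (conj oV Vy)).
  have fc : {for y, continuous f}.
    exact/differentiable_continuous/(smooth_diff (sfun_smooth f) Vy).
  exact: (cvgr_neq0 (f y)) fc fy.
have sub y : V' y -> V y by case.
apply: (@nabla_acs_nowhere_absurd R V' oV' G J _ _ _ _ _ _ _ _ _ (smoothfun oV')
  (@evp R V' oV') (@Dr R V' oV') (@evp_inj R V' oV') (@lift_smooth R V' oV')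
  (@evp_rsqrt R V' oV') (@Dr_mul R V' oV') (@Dr_comm R V' oV') (@evp_Dr R V' oV')
  k a b _ x).
- by move=> s y /sub; exact: G_smooth.
- by move=> s y /sub; exact: J_smooth.
- by move=> y /sub; exact: G_sym.
- by move=> y /sub; exact: G_pos.
- by move=> y /sub; exact: J_sqr.
- by move=> y /sub; exact: J_orth.
- by move=> y /sub; exact: closed.
- by move=> y /sub; exact: asd.
- by move=> y /sub; exact: ricci_J.
- by move=> y [Vy fy]; rewrite -fV.
- by split=> //; rewrite /= fV.
Qed.

Lemma acs_scalar_flat x : V x -> scalar_curvature G x = 0.
Proof.
apply: (parallel_scalar_curvature oV G_smooth J_smooth G_sym G_pos J_sqr J_orth asd
  ricci_J (@evp_inj R V oV) (@lift_smooth R V oV) (@evp_rsqrt R V oV) (@Dr_mul R V oV)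
  (@Dr_comm R V oV) (@evp_Dr R V oV)) => k y; exact: acs_parallel.
Qed.

End LocalTheorem.

(** * A parallel almost complex structure is integrable *)

Section DirectionalDerivatives.
Variables (R : realType) (n : nat).
Implicit Types (x v : 'rV[R]_n).

Lemma derive_pder (f : 'rV[R]_n -> R) x v : differentiable f x ->
  'D_v f x = \sum_k v 0 k * pder k f x.
Proof.
move=> df; rewrite deriveE // {1}(row_sum_delta v) linear_sum.
by apply: eq_bigr => k _; rewrite linearZ /= /pder deriveE.
Qed.

Lemma diff_entry p q (F : 'rV[R]_n -> 'M[R]_(p, q)) x a b : differentiable F x ->
  differentiable (fun y => F y a b) x.
Proof.
move=> dF; apply: (@differentiable_comp _ _ _ _ F (fun N : 'M[R]_(p, q) => N a b : R) x) => //.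
exact: differentiable_coord.
Qed.

Lemma derive_entry p q (F : 'rV[R]_n -> 'M[R]_(p, q)) x v a b : differentiable F x ->
  ('D_v F x) a b = \sum_k v 0 k * pder k (fun y => F y a b) x.
Proof.
move=> dF; rewrite derive_mx ?mxE; last exact: diff_derivable.
by rewrite derive_pder //; exact: diff_entry.
Qed.

Lemma derive_mulmx p q r (F : 'rV[R]_n -> 'M[R]_(p, q)) (H : 'rV[R]_n -> 'M[R]_(q, r)) x v :
  differentiable F x -> differentiable H x ->
  'D_v (fun y => F y *m H y) x = 'D_v F x *m H x + F x *m 'D_v H x.
Proof.
move=> dF dH.
have dFe a b : derivable (fun y => F y a b) x v by apply: diff_derivable; exact: diff_entry.
have dHe a b : derivable (fun y => H y a b) x v by apply: diff_derivable; exact: diff_entry.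
have E a b : (fun y => (F y *m H y) a b) = \sum_(m < q) (fun y => F y a m * H y m b).
  by apply/funext => y; rewrite mxE fct_sumE.
have dE a b : derivable (fun y => (F y *m H y) a b) x v.
  by rewrite E; apply: derivable_sum => m; exact: derivableM.
rewrite derive_mx; last exact/derivable_mxP.
apply/matrixP => a b; rewrite mxE E derive_sum; last by move=> m; exact: derivableM.
rewrite [RHS]mxE [('D_v F x *m _) a b]mxE [(_ *m 'D_v H x) a b]mxE -big_split.
apply: eq_bigr => m _ /=; rewrite [LHS]deriveM //.
have dFv : derivable F x v := diff_derivable dF.
have dHv : derivable H x v := diff_derivable dH.
rewrite (derive_mx dFv) (derive_mx dHv) !mxE [LHS]addrC.
by congr (_ + _); exact: mulrC.
Qed.

End DirectionalDerivatives.

Section Integrability.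
Variables (R : realType) (V : set 'rV[R]_4) (oV : open V).
Variables (G J : 'rV[R]_4 -> 'M[R]_4).
Hypothesis G_sym : forall x, V x -> (G x)^T = G x.
Hypothesis J_smooth : smooth_on V J.
Hypothesis J_sqr : forall x, V x -> J x *m J x = - 1%:M.
Hypothesis J_parallel : forall k x, V x -> nabla_acs G J k x = 0.

Lemma christoffel_sym l a b x : V x -> christoffel G l a b x = christoffel G l b a x.
Proof.
move=> Vx; rewrite /christoffel; congr (_ * _); apply: eq_bigr => m _; congr (_ * _).
have -> : pder m (fun y => G y a b) x = pder m (fun y => G y b a) x.
  by apply: (pder_eq_on oV) Vx => y Vy; rewrite -{1}(G_sym Vy) mxE.
by rewrite [X in X - _]addrC.
Qed.

Let Gv x (v : 'rV[R]_4) : 'M[R]_4 := \sum_k v 0 k *: christoffel_mx G k x.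

Let Gv_sym x (u v : 'rV[R]_4) : V x -> u *m Gv x v = v *m Gv x u.
Proof.
move=> Vx; apply/rowP => l; rewrite !mxE.
under eq_bigr => a _ do rewrite summxE mulr_sumr.
under [RHS]eq_bigr => a _ do rewrite summxE mulr_sumr.
rewrite exchange_big; apply: eq_bigr => a _; apply: eq_bigr => b _.
by rewrite !mxE (christoffel_sym l a b Vx); ring.
Qed.

Let derive_J x v : V x -> 'D_v J x = Gv x v *m J x - J x *m Gv x v.
Proof.
move=> Vx; apply/matrixP => a b; rewrite derive_entry; last exact: smooth_diff J_smooth Vx.
have -> : Gv x v *m J x - J x *m Gv x v =
    \sum_k v 0 k *: (christoffel_mx G k x *m J x - J x *m christoffel_mx G k x).
  rewrite /Gv mulmx_suml mulmx_sumr -sumrB; apply: eq_bigr => k _.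
  by rewrite -scalemxAl -scalemxAr scalerBr.
rewrite summxE; apply: eq_bigr => k _; rewrite mxE; congr (_ * _).
have /matrixP/(_ a b) := J_parallel k Vx.
rewrite /nabla_acs !(mxDE, mxNE) [fun_of_matrix (\matrix_(_, _) _) _ _]mxE [fun_of_matrix 0 _ _]mxE.
by move=> /eqP; rewrite -addrA addr_eq0 opprD opprK addrC => /eqP.
Qed.

(** The derivatives of the vector fields cancel in the Nijenhuis tensor.  What is
    left are derivatives of J, expressed by Christoffel symbols, which cancel by
    their symmetry. *)
Lemma parallel_integrable (X Y : 'rV[R]_4 -> 'rV[R]_4) x :
  smooth_on V X -> smooth_on V Y -> V x -> nijenhuis J X Y x = 0.
Proof.
move=> sX sY Vx.
have dX := smooth_diff sX Vx; have dY := smooth_diff sY Vx.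
have dJ := smooth_diff J_smooth Vx.
have DJ v (Z : 'rV[R]_4 -> 'rV[R]_4) : differentiable Z x ->
   'D_v (fun y => Z y *m J y) x = 'D_v Z x *m J x + Z x *m (Gv x v *m J x - J x *m Gv x v).
  by move=> dZ; rewrite -derive_J // -derive_mulmx.
rewrite /nijenhuis /lie_bracket /endo_app !DJ //.
rewrite !(mulmxDl, mulmxDr, mulNmx, mulmxN) !mulmxA.
have JJ (u : 'rV[R]_4) : u *m J x *m J x = - u by rewrite -mulmxA J_sqr // mulmxN mulmx1.
rewrite !JJ (Gv_sym (Y x) (X x *m J x)) // (Gv_sym (X x) (Y x *m J x)) //.
rewrite (Gv_sym (Y x *m J x) (X x *m J x)) // (Gv_sym (X x) (Y x)) //.
by apply/matrixP => s t; rewrite !(mxDE, mxNE) [RHS]mxE; ring.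
Qed.

End Integrability.

(** * From the charts to the manifold *)

Theorem corollary1 (R : realType) (M : manifold R 4) (S : almost_kahler M) :
  anti_self_dual S -> ricci_J_invariant S ->
  kahler S /\ scalar_flat (ak_metric S).
Proof.
move=> asd ricJ.
have oV i : open (chart_image i) := @crd_open _ _ M i.
have sG i := (metric_tensor (ak_metric S)).1 i.
have sJ i := (acs_tensor (ak_acs S)).1 i.
have closed i x (Vx : chart_image i x) a b c :
    ext_deriv2 (fun y => ak_acs S i y *m ak_metric S i y) a b c x = 0.
  rewrite -(@sform_closed _ _ _ (ak_form S) i x Vx a b c) /ext_deriv2.
  by congr (_ + _ + _); apply: (pder_eq_on (oV i)) Vx => y Vy; rewrite ak_compatible.
have par i := acs_parallel (oV i) (sG i) (sJ i) (@Defs.metric_sym _ _ _ (ak_metric S) i)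
  (@Defs.metric_pos _ _ _ (ak_metric S) i) (@acs_sqr _ _ _ (ak_acs S) i)
  (@ak_orthogonal _ _ _ S i) (closed i) (@asd i) (@ricJ i).
split=> [i X Y sX sY x Vx|i x Vx].
  apply: (parallel_integrable (oV i) (@Defs.metric_sym _ _ _ (ak_metric S) i) (sJ i)) Vx => //.
    exact: acs_sqr.
  by move=> k y; exact: par.
exact: (acs_scalar_flat (oV i) (sG i) (sJ i) (@Defs.metric_sym _ _ _ (ak_metric S) i)
  (@Defs.metric_pos _ _ _ (ak_metric S) i) (@acs_sqr _ _ _ (ak_acs S) i)
  (@ak_orthogonal _ _ _ S i) (closed i) (@asd i) (@ricJ i) Vx).
Qed.
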